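(* Let $X_1,X_2,\ldots$ be a sequence of i.i.d. lattice random variables with maximal span $h>0$, mean $\mu$ and finite variance, and let $\hat S_n=\frac{1}{\sqrt n}\sum_{i=1}^n X_i$, $n\ge1$. Then $$D\Big(\frac{1}{\sqrt n}\sum_{i=1}^n (X_i-\mu)\Big)=D(\hat S_n)\to 0\qquad\text{as } n\to\infty.$$
   Context: Throughout, $\log$ is the natural logarithm. A real random variable $Y$ has a lattice distribution with span $h>0$ if its support is a subset of $\{a+kh: k\in\mathbb{Z}\}$ for some $a\in\mathbb{R}$; the span $h$ is maximal if it is the largest such $h$ (in particular, a random variable with a maximal span is not almost surely constant). For probability mass functions $p,q$ on the same countable set $A$, the relative entropy is $D(p\|q)=\sum_{x\in A}p(x)\log\frac{p(x)}{q(x)}$. If $Y$ is a lattice random variable with maximal span $h$, values in $A=\{a+kh: k\in\mathbb{Z}\}$, mean $\mu$ and finite variance $\sigma^2$, then $D(Y)$ denotes $D(p\|q)$, where $p$ is the probability mass function of $Y$ and $q$ is the probability mass function on $A$ of a quantised Gaussian with the same mean and variance: $$q(a+kh)=\int_{a+kh}^{a+(k+1)h}\phi(x)\,dx,\qquad k\in\mathbb{Z},$$ with $\phi$ the $N(\mu,\sigma^2)$ density. (If the $X_i$ take values in $\{a+kh: k\in\mathbb{Z}\}$ with maximal span $h$, then $\hat S_n$ takes values in $\{\sqrt n\,a+kh/\sqrt n: k\in\mathbb{Z}\}$ with maximal span $h/\sqrt n$, and $D(\hat S_n)$ is defined with this lattice.) *)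

(* Defs.v *)
From HB Require Import structures.
From mathcomp Require Import all_boot all_order all_algebra finmap.
From mathcomp Require Import all_classical all_reals all_analysis measurable_realfun.
Import Order.TTheory GRing.Theory Num.Theory.
Import numFieldNormedType.Exports.

Set Implicit Arguments.
Unset Strict Implicit.
Unset Printing Implicit Defensive.

Local Open Scope classical_set_scope.
Local Open Scope ring_scope.

Section lattice_distributions.
Context d (T : measurableType d) (R : realType) (P : probability T R).

(* The support of the law of Y: the smallest closed set of full measure.
   As a lattice of positive span is closed, the support is contained in it
   if and only if Y takes its values in it almost surely. *)
Definition support_of (Y : {RV P >-> R}) : set R :=
  [set x | forall U : set R, open_nbhs x U -> (0 < P (Y @^-1` U))%E].

Definition lattice (a h : R) : set R := [set a + k%:~R * h | k in [set: int]].

Definition has_span (Y : {RV P >-> R}) (h : R) : Prop :=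
  0 < h /\ exists a, support_of Y `<=` lattice a h.

Definition has_maximal_span (Y : {RV P >-> R}) (h : R) : Prop :=
  has_span Y h /\ forall h', has_span Y h' -> h' <= h.

End lattice_distributions.

Arguments support_of {d T R} P Y.
Arguments has_span {d T R} P Y h.
Arguments has_maximal_span {d T R} P Y h.

Section relative_entropy.
Variable R : realType.
Local Open Scope ereal_scope.

(* p * log (p / q), with the conventions 0 * log (0 / q) = 0 and
   p * log (p / 0) = +oo for p > 0. *)
Definition entropy_term (p q : R) : \bar R :=
  if p == 0%R then 0 else if q == 0%R then +oo else (p * ln (p / q))%:E.

(* [esum] is meant for nonnegative families, hence the split of the sum of
   signed terms. For probability mass functions the negative part has a finite
   sum, so the difference is never of the form +oo - +oo. *)
Definition relative_entropy (A : set R) (p q : R -> R) : \bar R :=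
  let f x := entropy_term (p x) (q x) in
  \esum_(x in A) f^\+ x - \esum_(x in A) f^\- x.

End relative_entropy.

Section entropy_from_gaussian.
Context d (T : measurableType d) (R : realType) (P : probability T R).

(* Mass at the lattice point x of the quantised N(m, s ^+ 2). *)
Definition quantised_gaussian (m s h x : R) : R :=
  \int[lebesgue_measure]_(t in `[x, (x + h)%R]) normal_pdf m s t.

(* D(Y), for Y with values in [lattice a h] and maximal span h. *)
Definition gaussian_entropy (a h : R) (Y : {RV P >-> R}) : \bar R :=
  relative_entropy (lattice a h) (pmf Y)
    (quantised_gaussian (fine 'E_P[Y]) (Num.sqrt (fine 'V_P[Y])) h).

End entropy_from_gaussian.

Arguments gaussian_entropy {d T R} P a h Y.

Section iid.
Context d (T : measurableType d) (R : realType) (P : probability T R).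

Definition mutually_independent (X : nat -> {RV P >-> R}) : Prop :=
  forall (J : {fset nat}) (B : nat -> set R),
    (forall i, measurable (B i)) ->
    P (\bigcap_(i in [set` J]) X i @^-1` B i) =
    (\prod_(i <- J) P (X i @^-1` B i))%E.

Definition identically_distributed (X : nat -> {RV P >-> R}) : Prop :=
  forall i j (B : set R), measurable B ->
    distribution P (X i) B = distribution P (X j) B.

(* The sequence X_1, X_2, ... is indexed from 0. *)
Definition normalised_sum (X : nat -> {RV P >-> R}) (n : nat) (t : T) : R :=
  (Num.sqrt n%:R)^-1 * \sum_(i < n) X i t.

Lemma measurable_normalised_sum (X : nat -> {RV P >-> R}) (n : nat) :
  measurable_fun [set: T] (normalised_sum X n).
Proof.
apply: measurable_funM => //.
by apply: measurable_sum => i; exact: measurable_funP.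
Qed.

HB.instance Definition _ (X : nat -> {RV P >-> R}) (n : nat) :=
  isMeasurableFun.Build _ _ _ _ (normalised_sum X n)
    (measurable_normalised_sum X n).

Definition centred (X : nat -> {RV P >-> R}) (mu : R) (i : nat) :
  {RV P >-> R} := X i \- cst mu.

End iid.

Arguments mutually_independent {d T R} P X.
Arguments identically_distributed {d T R} P X.

(* Main.v *)
(* After centring, the local limit theorem comes from Fourier inversion on
   the lattice: with d = h / sqrt n, the error |P(S_n = x) - d * phi(x)| is at
   most d * I_n, where I_n is the L^1 distance over [- pi / d, pi / d] of the
   characteristic functions (plus a Gaussian tail). It tends to 0 by dominated
   convergence, because maximality of the span gives |E exp(i t X)|^2 <=
   exp(- k t^2) for |t| <= pi / h.
   Relative entropy is nonnegative by Gibbs' inequality. For the upper bound,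
   ln (p / q) is uniformly small on |x| <= M by the local limit theorem, and at
   most K * x^2 on |x| > M since p <= C * d; the remaining E[S_n^2; |S_n| > M]
   is small uniformly in n because 2 (1 - cos (u x)) / u^2 approximates x^2 from
   below and its expectation is a value of the characteristic function.
   Characteristic functions are handled through their real and imaginary
   parts. *)

Require Import Defs.
From HB Require Import structures.
From mathcomp Require Import all_boot all_order all_algebra finmap.
From mathcomp Require Import all_classical all_reals all_analysis measurable_realfun.
From mathcomp Require Import ring lra.
Import Order.TTheory GRing.Theory Num.Theory.
Import numFieldNormedType.Exports.

Set Implicit Arguments.
Unset Strict Implicit.
Unset Printing Implicit Defensive.

Local Open Scope classical_set_scope.
Local Open Scope ring_scope.

(** With only a second moment, no rate of convergence is available: the Taylor remainders of the
    characteristic function are controlled by dominated convergence, with [u ^ 2 X ^ 2] as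
    dominating function. Decay away from 0 is the arithmetic point. The integers [k] for which
    [sin (t k h / 2) ^ 2] is at most a constant times [1 - |E exp(i t X)|^2], uniformly in [t], form
    a subgroup that contains the differences of atoms, and a maximal span forces it to contain 1.
    The local limit theorem has an additive error, which says nothing about the logarithm where the
    Gaussian mass is tiny; the crude quadratic bound used there has to be paid for by uniform
    integrability of the squares of the sums. The parameters are fixed in the order [e], [u],
    [M = 3 / u], [n]: one part of the tail estimate is small with [u] for all [n], and the rest
    vanishes as [n] grows. Uncentred sums come last, by translation. *)

(** * Taylor bounds for sine, cosine and exponential *)

Section trigonometric_bounds.
Variable R : realType.
Implicit Types x y : R.

(** Mean value theorem. The Taylor bounds below climb one degree at a time with it: [cos <= 1] gives
    [sin_le_id], which gives [cos_ge_taylor2], and so on. *)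
Lemma derive_ge0_ge0 (f df : R -> R) : (forall x, is_derive x 1 f (df x)) ->
  f 0 = 0 -> (forall x, 0 <= x -> 0 <= df x) -> forall x, 0 <= x -> 0 <= f x.
Proof.
move=> fdf f0 df0 x x0.
have cf : {within `[0, x], continuous f}.
  apply: derivable_within_continuous => y _.
  exact: (@ex_derive _ _ _ _ _ _ _ (fdf y)).
have [c + fx] := MVT_segment x0 (fun y _ => fdf y) cf.
rewrite in_itv/= => /andP[c0 _].
by move: fx; rewrite f0 !subr0 => ->; rewrite mulr_ge0// df0.
Qed.

Lemma is_derive_pow n x : is_derive x 1 (@GRing.exp R ^~ n.+1) (n.+1%:R * x ^+ n).
Proof.
have h : is_derive x 1 (id ^+ n.+1 : R -> R) _ := is_deriveX _ (is_derive_id _ _).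
rewrite (_ : @GRing.exp R ^~ n.+1 = id ^+ n.+1); last first.
  by apply/funext => y; rewrite fctE.
by apply: (is_derive_eq h); rewrite /GRing.scale/= mulr1.
Qed.

Lemma sin_le_id x : 0 <= x -> sin x <= x.
Proof.
move=> x0; rewrite -subr_ge0.
pose df y := 1 - cos y.
have fdf y : is_derive y 1 _ (df y) :=
  is_deriveB (is_derive_id y 1) (is_derive_sin y).
apply: (derive_ge0_ge0 fdf _ _ x0) => [|y y0].
- by rewrite !fctE/= sin0 subrr.
- by rewrite subr_ge0 cos_le1.
Qed.

Lemma cos_ge_taylor2 x : 1 - x ^+ 2 / 2 <= cos x.
Proof.
wlog x0 : x / 0 <= x.
  move=> h; have [/h//|/ltW x0] := leP 0 x.
  by rewrite -cosN -sqrrN h// oppr_ge0.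
rewrite -subr_ge0.
suff : 0 <= (cos - (cst 1 - 2^-1 *: (@GRing.exp _ ^~ 2%N))) x.
  by rewrite !fctE/= /GRing.scale/= mulrC.
pose df y := - sin y - (0 - 2^-1 *: (2%:R * y ^+ 1)).
have fdf y : is_derive y 1 _ (df y) :=
  is_deriveB (is_derive_cos y) (is_deriveB (is_derive_cst (1 : R^o) y (1 : R))
    (is_deriveZ 2^-1 (is_derive_pow 1 y))).
apply: (derive_ge0_ge0 fdf _ _ x0) => [|y y0].
- by rewrite !fctE/= cos0 expr0n/= scaler0; ring.
- by rewrite /df; have := sin_le_id y0; rewrite /GRing.scale/=; lra.
Qed.

Lemma sin_ge_taylor3 x : 0 <= x -> x - x ^+ 3 / 6 <= sin x.
Proof.
move=> x0; rewrite -subr_ge0.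
suff : 0 <= (sin - (id - 6^-1 *: (@GRing.exp _ ^~ 3%N))) x.
  by rewrite !fctE/= /GRing.scale/= mulrC.
pose df y := cos y - (1 - 6^-1 *: (3%:R * y ^+ 2)).
have fdf y : is_derive y 1 _ (df y) :=
  is_deriveB (is_derive_sin y) (is_deriveB (is_derive_id y 1)
    (is_deriveZ 6^-1 (is_derive_pow 2 y))).
apply: (derive_ge0_ge0 fdf _ _ x0) => [|y y0].
- by rewrite !fctE/= sin0 expr0n/= scaler0; ring.
- by rewrite /df; have := cos_ge_taylor2 y; rewrite /GRing.scale/=; lra.
Qed.

Lemma cos_le_taylor4 x : cos x <= 1 - x ^+ 2 / 2 + x ^+ 4 / 24.
Proof.
wlog x0 : x / 0 <= x.
  move=> h; have [/h//|/ltW x0] := leP 0 x.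
  have := h (- x); rewrite oppr_ge0 cosN sqrrN (_ : (- x) ^+ 4 = x ^+ 4) => [/(_ x0)//|]; ring.
rewrite -subr_ge0.
suff : 0 <= ((cst 1 - 2^-1 *: (@GRing.exp _ ^~ 2%N)) + 24^-1 *: (@GRing.exp _ ^~ 4%N) - cos) x.
  by rewrite !fctE/= /GRing.scale/= [_ * x ^+ 2]mulrC [_ * x ^+ 4]mulrC.
pose df y := (0 - 2^-1 *: (2%:R * y ^+ 1)) + 24^-1 *: (4%:R * y ^+ 3) - - sin y.
have fdf y : is_derive y 1 _ (df y) :=
  is_deriveB (is_deriveD (is_deriveB (is_derive_cst (1 : R^o) y (1 : R))
    (is_deriveZ 2^-1 (is_derive_pow 1 y))) (is_deriveZ 24^-1 (is_derive_pow 3 y)))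
    (is_derive_cos y).
apply: (derive_ge0_ge0 fdf _ _ x0) => [|y y0].
- by rewrite !fctE/= cos0 !expr0n/= !scaler0; ring.
- by rewrite /df; have := sin_ge_taylor3 y0; rewrite /GRing.scale/=; lra.
Qed.

Lemma normr_cos_taylor2_le x : `|cos x - 1 + x ^+ 2 / 2| <= x ^+ 4 / 24.
Proof.
rewrite ger0_norm; last by have := cos_ge_taylor2 x; lra.
by have := cos_le_taylor4 x; lra.
Qed.

(** Under a second moment this quadratic bound supplies the dominating function, while the quartic
    one above yields the pointwise limit. The sine gets a similar pair below. *)
Lemma normr_cos_taylor2_le_sqr x : `|cos x - 1 + x ^+ 2 / 2| <= x ^+ 2.
Proof.
rewrite ger0_norm; last by have := cos_ge_taylor2 x; lra.
by have := cos_le1 x; have := sqr_ge0 x; lra.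
Qed.

Lemma normr_sin_taylor1_le x : `|sin x - x| <= `|x| ^+ 3 / 6.
Proof.
wlog x0 : x / 0 <= x.
  move=> h; have [/h//|/ltW x0] := leP 0 x.
  by have := h (- x); rewrite oppr_ge0 sinN normrN opprK addrC distrC => /(_ x0).
rewrite distrC ger0_norm; last by have := sin_le_id x0; lra.
by rewrite ger0_norm//; have := sin_ge_taylor3 x0; lra.
Qed.

Lemma normr_sin_taylor1_le_sqr x : `|sin x - x| <= x ^+ 2.
Proof.
wlog x0 : x / 0 <= x.
  move=> h; have [/h//|/ltW x0] := leP 0 x.
  by have := h (- x); rewrite oppr_ge0 sinN sqrrN opprK addrC distrC => /(_ x0).
rewrite distrC ger0_norm; last by have := sin_le_id x0; lra.
(* Below 6 the cubic remainder [x ^ 3 / 6] is at most [x ^ 2]; beyond 6,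
   [x - sin x <= x + 1 <= 6 x <= x ^ 2]. *)
have [x6|x6] := leP x 6.
  have := sin_ge_taylor3 x0.
  have : x ^+ 3 <= 6 * x ^+ 2 by rewrite exprS ler_wpM2r// sqr_ge0.
  lra.
have := sin_geN1 x; have : 6 * x <= x ^+ 2 by rewrite expr2 ler_wpM2r// ltW.
lra.
Qed.

(** Because [pi / 2 < 2], the Taylor term [x ^ 3 / 6] is at most [2 x / 3], which leaves the slope
    1/3. Its square is the 9 in the later decay rate. *)
Lemma sin_ge_third x : 0 <= x <= pi / 2 -> x / 3 <= sin x.
Proof.
move=> /andP[x0 xpi]; have x2 : x < 2 := le_lt_trans xpi (pihalf_lt2 R).
have := sin_ge_taylor3 x0.
have : x ^+ 3 <= 4 * x by rewrite exprSr ler_wpM2r//; nra.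
lra.
Qed.

Lemma sqr_sin_ge x : `|x| <= pi / 2 -> x ^+ 2 / 9 <= sin x ^+ 2.
Proof.
wlog x0 : x / 0 <= x.
  move=> h; have [/h//|/ltW x0] := leP 0 x => xpi.
  by have := h (- x); rewrite oppr_ge0 sinN normrN !sqrrN => /(_ x0 xpi).
rewrite ger0_norm// => xpi; have /sin_ge_third : 0 <= x <= pi / 2 by rewrite x0.
nra.
Qed.

(** Once the cosines of the addition formula are bounded by 1, this is
    [(a + b) ^ 2 <= 2 (a ^ 2 + b ^ 2)]. It makes the set [G] of the maximal span argument closed
    under subtraction. *)
Lemma sqr_sin_D_le x y : sin (x + y) ^+ 2 <= 2 * (sin x ^+ 2 + sin y ^+ 2).
Proof.
have h (a b c d : R) : c ^+ 2 <= 1 -> d ^+ 2 <= 1 ->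
    (a * d + c * b) ^+ 2 <= 2 * (a ^+ 2 + b ^+ 2).
  move=> c1 d1; have : (a * d) ^+ 2 <= a ^+ 2.
    by rewrite exprMn ler_piMr// sqr_ge0.
  have : (c * b) ^+ 2 <= b ^+ 2 by rewrite exprMn ler_piMl// sqr_ge0.
  have := sqr_ge0 (a * d - c * b).
  nra.
by rewrite sinD; apply: h; have := cos2Dsin2 x; have := cos2Dsin2 y;
  have := sqr_ge0 (sin x); have := sqr_ge0 (sin y); lra.
Qed.

Lemma subr1_cosE x : 1 - cos x = 2 * sin (x / 2) ^+ 2.
Proof.
have -> : cos x = cos (x / 2 + x / 2) by congr cos; lra.
by have := cos2Dsin2 (x / 2); rewrite cosD -!expr2; lra.
Qed.

Lemma expRN_le_taylor2 x : 0 <= x -> expR (- x) <= 1 - x + x ^+ 2 / 2.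
Proof.
move=> x0; rewrite -subr_ge0.
suff : 0 <= ((cst 1 - id) + 2^-1 *: (@GRing.exp _ ^~ 2%N) - (expR \o -%R)) x.
  by rewrite !fctE/= /GRing.scale/= [_ * x ^+ 2]mulrC.
pose df (y : R) : R := (0 - 1) + 2^-1 *: (2%:R * y ^+ 1) - expR (- y) * -1.
have fdf y : is_derive y 1 _ (df y) :=
  is_deriveB (is_deriveD (is_deriveB (is_derive_cst (1 : R^o) y (1 : R)) (is_derive_id y 1))
    (is_deriveZ 2^-1 (is_derive_pow 1 y)))
    (is_derive1_comp (is_derive_expR (- y)) (is_deriveN (is_derive_id y 1))).
apply: (derive_ge0_ge0 fdf _ _ x0) => [|y y0].
- by rewrite !fctE/= oppr0 expR0 !expr0n/= !scaler0; ring.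
- have := expR_ge1Dx (- y); rewrite /df /GRing.scale/=; lra.
Qed.

End trigonometric_bounds.

(** * Fourier transform of the Gaussian *)

Section gaussian_fourier.
Variable R : realType.
Notation mu := (@lebesgue_measure R).
Implicit Types c x u : R.

Lemma cvg_integral_itvN (f : R -> R) : mu.-integrable setT (EFin \o f) ->
  (\int[mu]_(x in `[(- n%:R)%R, n%:R]) (f x)%:E)%E @[n --> \oo] -->
  (\int[mu]_x (f x)%:E)%E.
Proof.
move=> intf; have mf := measurable_int _ intf.
under eq_fun do rewrite integral_mkcond.
apply: (@dominated_cvg _ _ _ mu setT measurableT _ _ (abse \o (EFin \o f))) => //.
- move=> n; apply/(measurable_restrictT _ _).1 => //.
  exact: measurable_funTS.
- move=> x _; apply: cvg_near_cst; near=> n; rewrite patchE ifT// inE/= in_itv/=.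
  rewrite -ler_norml; near: n; exact: nbhs_infty_ger.
- exact: integrable_abse.
- move=> n x _; rewrite patchE; case: ifP => //= _.
  by rewrite normr0 lee_fin.
Unshelve. all: by end_near. Qed.

Lemma continuous_is_derive (f df : R -> R) : (forall x : R, is_derive x 1 f (df x)) ->
  continuous f.
Proof.
move=> fdf x; apply/differentiable_continuous/derivable1_diffP.
exact: (@ex_derive _ _ _ _ _ _ _ (fdf x)).
Qed.

Lemma integral_is_derive (f F : R -> R) (a b : R) : a < b -> continuous f ->
  (forall x : R, is_derive x 1 F (f x)) ->
  (\int[mu]_(x in `[a, b]) (f x)%:E)%E = (F b - F a)%:E.
Proof.
move=> ab cf dF; have cF := continuous_is_derive dF.
rewrite (@continuous_FTC2 _ f F)//.
- exact: continuous_subspaceT.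
- split => //.
  + by apply: cvg_at_right_filter; exact: cF.
  + by apply: cvg_at_left_filter; exact: cF.
- by move=> x _; rewrite derive1E; exact: (@derive_val _ _ _ _ _ _ _ (dF x)).
Qed.

(** The integral is exhausted by the segments [[- n, n]], so limits of the primitive along the
    integers are enough. This serves as integration by parts with vanishing boundary terms. *)
Lemma integral_derive_eq0 (f F : R -> R) : continuous f ->
  (forall x, is_derive x 1 F (f x)) -> mu.-integrable setT (EFin \o f) ->
  F n%:R @[n --> \oo] --> 0 -> F (- n%:R) @[n --> \oo] --> 0 ->
  (\int[mu]_x (f x)%:E)%E = 0%E.
Proof.
move=> cf dF intf Fp Fn; have /cvg_lim <-// := cvg_integral_itvN intf.
apply/cvg_lim => //; have : (F n%:R - F (- n%:R))%:E @[n --> \oo] --> (0 : R)%:E.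
  apply: cvg_EFin; first exact: nearW.
  by rewrite -[0]subr0; exact: cvgB.
apply: cvg_trans; apply: near_eq_cvg; near=> n.
have n0 : (- n%:R < n%:R :> R).
  by rewrite gtrN// ltr0n; near: n; exact: nbhs_infty_gt.
exact/esym/integral_is_derive.
Unshelve. all: by end_near. Qed.

(** Parametrised by a rate rather than a variance, because it plays several roles: limiting
    characteristic function ([c = v / 2]), shape of the density ([c = 1 / (2 s ^ 2)]), decay bound,
    and even, with a negative rate, reciprocal of a Gaussian. *)
Definition gauss c u := expR (- (c * u ^+ 2)).

Lemma gauss_ge0 c u : 0 <= gauss c u.
Proof. exact: expR_ge0. Qed.

Lemma measurable_gauss c : measurable_fun setT (gauss c).
Proof.
apply: measurableT_comp => //; apply: measurableT_comp => //.
by apply: measurable_funM => //; exact: measurable_funX.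
Qed.

Lemma is_derive_gauss c u : is_derive u 1 (gauss c) (- (2 * c * u) * gauss c u).
Proof.
have h := is_deriveN (is_deriveZ c (is_derive_pow 1 u)).
have := is_derive1_comp (is_derive_expR _) h.
have -> : expR \o (- (c \*: (@GRing.exp R ^~ 2%N))) = gauss c by apply/funext.
by move=> h'; apply: (is_derive_eq h'); rewrite /GRing.scale/= /gauss; ring.
Qed.

Lemma continuous_gauss c : continuous (gauss c).
Proof.
exact: continuous_is_derive (is_derive_gauss c).
Qed.

Lemma gauss_normal_pdf c u : 0 < c ->
  gauss c u = Num.sqrt (pi / c) * normal_pdf 0 (Num.sqrt (2 * c)^-1) u.
Proof.
move=> c0; have s0 : Num.sqrt (2 * c)^-1 != 0.
  by rewrite sqrtr_eq0 -ltNge invr_gt0 mulr_gt0.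
rewrite normal_pdfE// /normal_peak /normal_fun sqr_sqrtr; last first.
  by rewrite invr_ge0 mulr_ge0// ltW.
have -> : (2 * c)^-1 * pi *+ 2 = pi / c by rewrite -mulr_natr; field; rewrite gt_eqF.
rewrite mulrA divff ?mul1r; last first.
  by rewrite sqrtr_eq0 -ltNge divr_gt0// pi_gt0.
by rewrite /gauss; congr expR; rewrite subr0 -mulr_natr; field; rewrite gt_eqF.
Qed.

Lemma integrable_gauss c : 0 < c -> mu.-integrable setT (EFin \o gauss c).
Proof.
move=> c0; rewrite (_ : EFin \o gauss c = (fun u => (Num.sqrt (pi / c))%:E *
    (normal_pdf 0 (Num.sqrt (2 * c)^-1) u)%:E)%E).
  by apply: integrableZl => //; exact: integrable_normal_pdf.
by apply/funext => u/=; rewrite gauss_normal_pdf.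
Qed.

Lemma integral_gauss c : 0 < c -> \int[mu]_u gauss c u = Num.sqrt (pi / c).
Proof.
move=> c0; rewrite /Rintegral; under eq_integral do rewrite gauss_normal_pdf// EFinM.
rewrite integralZl//; last exact: integrable_normal_pdf.
by rewrite integral_normal_pdf mule1.
Qed.

(** Half of the exponent absorbs the factor [u]: [|u| <= 1 + u ^ 2 <= (1 + 2 / c) (1 + c u ^ 2 /
    2)], and the last factor is at most [exp (c u ^ 2 / 2)]. *)
Lemma gauss_id_le c u : 0 < c ->
  `|u * gauss c u| <= (1 + 2 / c) * gauss (c / 2) u.
Proof.
move=> c0; rewrite normrM (ger0_norm (gauss_ge0 _ _)).
have -> : gauss c u = gauss (c / 2) u * gauss (c / 2) u.
  by rewrite /gauss -expRD; congr expR; lra.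
rewrite mulrA ler_wpM2r ?gauss_ge0//.
have : `|u| <= (1 + 2 / c) * expR (c / 2 * u ^+ 2).
  have u1 : `|u| <= 1 + u ^+ 2.
    rewrite -[u ^+ 2]real_normK ?num_real//; have := sqr_ge0 (`|u| - 1).
    by have := normr_ge0 u; lra.
  have := expR_ge1Dx (c / 2 * u ^+ 2) => e1.
  apply: (le_trans u1).
  apply: (@le_trans _ _ ((1 + 2 / c) * (1 + c / 2 * u ^+ 2))); last first.
    by rewrite ler_wpM2l// addr_ge0// divr_ge0// ltW.
  have -> : (1 + 2 / c) * (1 + c / 2 * u ^+ 2) =
            1 + u ^+ 2 + (2 / c + c / 2 * u ^+ 2) by field; rewrite gt_eqF.
  by rewrite lerDl addr_ge0//; [|apply: mulr_ge0; rewrite ?sqr_ge0//]; rewrite divr_ge0// ltW.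
move=> /(ler_wpM2r (gauss_ge0 (c / 2) u)) /le_trans; apply.
by rewrite -[leLHS]mulrA /gauss -expRD subrr expR0 mulr1.
Qed.

Lemma integrable_id_gauss c : 0 < c ->
  mu.-integrable setT (fun u => (u * gauss c u)%:E).
Proof.
move=> c0; apply: (@le_integrable _ _ _ mu setT measurableT _
    (fun u => ((1 + 2 / c) * gauss (c / 2) u)%:E)).
- by apply/measurable_EFinP/measurable_funM => //; exact: measurable_gauss.
- move=> u _; rewrite lee_fin (le_trans (gauss_id_le _ c0))// ger0_norm//.
  by rewrite mulr_ge0 ?gauss_ge0// addr_ge0// divr_ge0// ltW.
- under eq_fun do rewrite EFinM.
  by apply: integrableZl => //; apply: integrable_gauss; rewrite divr_gt0.
Qed.

Let fourier_gauss c x := \int[mu]_u (cos (u * x) * gauss c u).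

Lemma continuous_cosM x : continuous (fun u : R => cos (u * x)).
Proof.
move=> u; apply: (@continuous_comp _ _ _ (fun u : R => u * x) cos).
  by apply: cvgM; [exact: cvg_id|exact: cvg_cst].
exact: continuous_cos.
Qed.

Lemma continuous_sinM x : continuous (fun u : R => sin (u * x)).
Proof.
move=> u; apply: (@continuous_comp _ _ _ (fun u : R => u * x) sin).
  by apply: cvgM; [exact: cvg_id|exact: cvg_cst].
exact: continuous_sin.
Qed.

Lemma measurable_cosM x : measurable_fun setT (fun u : R => cos (u * x)).
Proof. by apply: continuous_measurable_fun; exact: continuous_cosM. Qed.

Lemma measurable_sinM x : measurable_fun setT (fun u : R => sin (u * x)).
Proof. by apply: continuous_measurable_fun; exact: continuous_sinM. Qed.

Lemma integrable_le_norm (f g : R -> R) : measurable_fun setT f ->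
  mu.-integrable setT (EFin \o g) -> (forall u, `|f u| <= `|g u|) ->
  mu.-integrable setT (EFin \o f).
Proof.
move=> mf ig fg; apply: le_integrable ig => //; first exact/measurable_EFinP.
by move=> u _; rewrite lee_fin.
Qed.

Lemma integrable_cos_gauss c x : 0 < c ->
  mu.-integrable setT (EFin \o (fun u => cos (u * x) * gauss c u)).
Proof.
move=> c0; apply: integrable_le_norm (integrable_gauss c0) _.
- by apply: measurable_funM; [exact: measurable_cosM|exact: measurable_gauss].
- by move=> u; rewrite normrM ler_piMl// cos_max.
Qed.

Lemma integrable_sin_gauss c x : 0 < c ->
  mu.-integrable setT (EFin \o (fun u => sin (u * x) * (u * gauss c u))).
Proof.
move=> c0; apply: integrable_le_norm (integrable_id_gauss c0) _.
- apply: measurable_funM; first exact: measurable_sinM.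
  by apply: measurable_funM => //; exact: measurable_gauss.
- by move=> u; rewrite normrM ler_piMl// sin_max.
Qed.

Let is_derive_sinM x u : is_derive u 1 (fun u : R => sin (u * x)) (x * cos (u * x)).
Proof.
have h : is_derive u 1 (x \*: (@id R)) _ := is_deriveZ x (is_derive_id u 1).
have := is_derive1_comp (is_derive_sin _) h.
have -> : sin \o (x \*: (@id R)) = (fun u : R => sin (u * x)).
  by apply/funext => y /=; rewrite mulrC.
have -> : (x \*: (@id R)) u = u * x by rewrite /= /GRing.scale/= mulrC.
by move=> h'; apply: (is_derive_eq h'); rewrite /GRing.scale/= mulr1 mulrC.
Qed.

Let is_derive_cosM u x : is_derive x 1 (fun x : R => cos (u * x)) (- (u * sin (u * x))).
Proof.
have h : is_derive x 1 (u \*: (@id R)) _ := is_deriveZ u (is_derive_id x 1).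
have := is_derive1_comp (is_derive_cos _) h.
have -> : cos \o (u \*: (@id R)) = (fun x : R => cos (u * x)) by apply/funext.
by move=> h'; apply: (is_derive_eq h'); rewrite /GRing.scale/= mulr1 mulNr mulrC.
Qed.

Lemma cvg_natV : (n%:R^-1 : R) @[n --> \oo] --> 0.
Proof. rewrite -(cvg_shiftS (fun n => n%:R^-1 : R)); exact: cvg_harmonic. Qed.

Lemma cvg_gauss_nat c : 0 < c -> gauss c n%:R @[n --> \oo] --> 0.
Proof.
move=> c0; apply: (@squeeze_cvgr _ _ _ _ (cst 0) (fun n => c^-1 * n%:R^-1)).
- near=> n; rewrite gauss_ge0/= /gauss expRN -invfM lef_pV2 ?posrE ?expR_gt0//; last first.
    by rewrite mulr_gt0// ltr0n; near: n; exact: nbhs_infty_gt.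
  apply: le_trans (expR_ge1Dx _); rewrite -natrX.
  have : c * n%:R <= c * (n ^ 2)%:R by rewrite ler_pM2l// ler_nat expnS expn1 leq_pmulr//; near: n; exact: nbhs_infty_gt.
  by lra.
- exact: cvg_cst.
- rewrite -[0](mulr0 c^-1); apply: cvgMr; exact: cvg_natV.
Unshelve. all: by end_near. Qed.

(* Integration by parts turns the derivative of the transform back into the
   transform, so that it satisfies y' = - x / (2 c) * y. *)
Lemma fourier_gauss_ibp c x : 0 < c ->
  x * fourier_gauss c x = 2 * c * \int[mu]_u (sin (u * x) * (u * gauss c u)).
Proof.
move=> c0; apply/eqP; rewrite -subr_eq0 -!RintegralZl//; first last.
- exact: integrable_sin_gauss.
- exact: integrable_cos_gauss.
pose f u := x * (cos (u * x) * gauss c u) - 2 * c * (sin (u * x) * (u * gauss c u)).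
have icos : mu.-integrable setT (EFin \o (fun u => x * (cos (u * x) * gauss c u))).
  rewrite /comp; under eq_fun do rewrite EFinM.
  by apply: integrableZl => //; exact: integrable_cos_gauss.
have isin : mu.-integrable setT (EFin \o (fun u => 2 * c * (sin (u * x) * (u * gauss c u)))).
  rewrite /comp; under eq_fun do rewrite EFinM.
  by apply: integrableZl => //; exact: integrable_sin_gauss.
rewrite -RintegralB// /Rintegral.
suff -> : (\int[mu]_u (f u)%:E = 0)%E by [].
apply: (@integral_derive_eq0 _ (fun u => sin (u * x) * gauss c u)).
- move=> u; apply: cvgB.
    apply: cvgMr; apply: cvgM; [exact: continuous_cosM|exact: continuous_gauss].
  apply: cvgMr; apply: cvgM; first exact: continuous_sinM.
  by apply: cvgM; [exact: cvg_id|exact: continuous_gauss].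
- move=> u; apply: (is_derive_eq (is_deriveM (is_derive_sinM x u) (is_derive_gauss c u))).
  by rewrite /GRing.scale/= /f; ring.
- by apply: eq_integrable (integrableB measurableT icos isin).
- apply: (@squeeze_cvgr _ _ _ _ (fun n => - gauss c n%:R) (fun n => gauss c n%:R)).
  + apply: nearW => n; rewrite -ler_norml normrM (ger0_norm (gauss_ge0 _ _)).
    by rewrite ler_piMl ?gauss_ge0// sin_max.
  + by rewrite -oppr0; apply: cvgN; exact: cvg_gauss_nat.
  + exact: cvg_gauss_nat.
- apply: (@squeeze_cvgr _ _ _ _ (fun n => - gauss c n%:R) (fun n => gauss c n%:R)).
  + apply: nearW => n; rewrite -ler_norml normrM (ger0_norm (gauss_ge0 _ _)).
    by rewrite [gauss c (- _)]/gauss sqrrN ler_piMl ?gauss_ge0// sin_max.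
  + by rewrite -oppr0; apply: cvgN; exact: cvg_gauss_nat.
  + exact: cvg_gauss_nat.
Qed.

Lemma is_derive_fourier_gauss c x : 0 < c ->
  is_derive x 1 (fourier_gauss c) (- (x / (2 * c)) * fourier_gauss c x).
Proof.
move=> c0.
pose f x u := cos (u * x) * gauss c u.
have df (y u : R) : is_derive y 1 (f ^~ u) (- (sin (u * y) * (u * gauss c u))).
  have h := is_deriveM (is_derive_cosM u y) (is_derive_cst (gauss c u : R^o) y (1:R)).
  by apply: (is_derive_eq h); rewrite /GRing.scale/= mulr0; ring.
have d1f y u : partial1of2 f y u = - (sin (u * y) * (u * gauss c u)).
  by rewrite partial1of2E; exact: (@derive_val _ _ _ _ _ _ _ (df y u)).
(* The window of radius 1 is arbitrary, since the dominating function [|u * gauss c u|] is the same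
   at every point. *)
have xI : `]x - 1, x + 1[%classic x by rewrite /= in_itv/= ltrBlDr ltrDl ltr01.
have fub y u : `|partial1of2 f y u| <= `|u * gauss c u|.
  by rewrite d1f normrN normrM ler_piMl// sin_max.
have int1 y : mu.-integrable setT (EFin \o f y) by exact: integrable_cos_gauss.
have int2 : mu.-integrable setT (EFin \o (fun u => `|u * gauss c u|)).
  apply: (integrable_le_norm _ (integrable_id_gauss c0)).
    apply: measurableT_comp => //.
    by apply: measurable_funM => //; exact: measurable_gauss.
  by move=> u; rewrite normr_id.
apply: DeriveDef.
  apply: (@derivable_under_integral _ _ _ mu f setT measurableT x _ _ xI _ _ (fun u => `|u * gauss c u|)) => //.
rewrite -derive1E.
rewrite (@differentiation_under_integral _ _ _ mu f setT measurableT x _ _ xI _ _ (fun u => `|u * gauss c u|))//.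
under eq_Rintegral do rewrite d1f -mulN1r.
rewrite RintegralZl//; last exact: integrable_sin_gauss.
have -> : - (x / (2 * c)) * fourier_gauss c x = - (x * fourier_gauss c x) / (2 * c).
  by field; rewrite gt_eqF.
by rewrite fourier_gauss_ibp//; field; rewrite gt_eqF.
Qed.

Lemma fourier_gaussE c x : 0 < c ->
  \int[mu]_u (cos (u * x) * gauss c u) = Num.sqrt (pi / c) * gauss (4 * c)^-1 x.
Proof.
(* [gauss (- (4 * c)^-1)] is the reciprocal of the expected answer. By the differential equation the
   product [H] is constant, and its value at 0 is the Gaussian integral. *)
move=> c0; pose H y := fourier_gauss c y * gauss (- (4 * c)^-1) y.
have dH (y : R) : is_derive y 1 H 0.
  have h := is_deriveM (is_derive_fourier_gauss y c0) (is_derive_gauss (- (4 * c)^-1) y).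
  by apply: (is_derive_eq h); rewrite /GRing.scale/=; field; rewrite gt_eqF.
have H0 : H x = H 0.
  by apply: is_derive_0_is_cst.
have H0E : H 0 = Num.sqrt (pi / c).
  rewrite /H /gauss expr0n/= mulr0 oppr0 expR0 mulr1 -integral_gauss//.
  by apply: eq_Rintegral => u _; rewrite mulr0 cos0 mul1r.
rewrite -H0E -H0 /H -mulrA /gauss -expRD (_ : _ + _ = 0) ?expR0 ?mulr1//.
by ring.
Qed.

(** Writes the density as an inverse transform, so that in the local limit theorem it can be
    subtracted from the lattice inversion formula under a single integral. *)
Lemma normal_pdf_fourier (s x : R) : 0 < s ->
  normal_pdf 0 s x = (2 * pi)^-1 * \int[mu]_u (cos (u * x) * gauss (s ^+ 2 / 2) u).
Proof.
move=> s0; have s20 : 0 < s ^+ 2 by rewrite exprn_gt0.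
have pi0 := pi_gt0 R.
rewrite fourier_gaussE ?divr_gt0// normal_pdfE ?gt_eqF//.
rewrite [RHS]mulrA; congr (_ * _); last first.
  rewrite /normal_fun /gauss subr0 -mulr_natr; congr expR.
  by field; rewrite gt_eqF.
rewrite /normal_peak.
have a0 : 0 < 2 * pi :> R by rewrite mulr_gt0.
have -> : s ^+ 2 * pi *+ 2 = (2 * pi) * s ^+ 2 by rewrite -mulr_natr; ring.
have -> : pi / (s ^+ 2 / 2) = (2 * pi) * s^-1 ^+ 2 by field; rewrite gt_eqF.
rewrite !(sqrtrM _ (ltW a0)) !sqrtr_sqr !gtr0_norm ?invr_gt0//.
rewrite -[X in X^-1 * _](sqr_sqrtr (ltW a0)).
have : Num.sqrt (2 * pi) != 0 :> R by rewrite gt_eqF// sqrtr_gt0.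
set r := Num.sqrt _ => r0; field; rewrite r0 gt_eqF//.
Qed.

End gaussian_fourier.

(** * Independence of a partial sum from the next term *)

Section independence.
Context d (T : measurableType d) (R : realType) (P : probability T R).
Local Open Scope ereal_scope.

Section pair.
Variables X Y : {RV P >-> R}.

Definition pair_rv (w : T) : R * R := (X w, Y w).

Lemma measurable_pair_rv : measurable_fun [set: T] pair_rv.
Proof. exact: measurable_fun_pair. Qed.

HB.instance Definition _ := isMeasurableFun.Build _ _ _ _ pair_rv measurable_pair_rv.

Definition independent_rv := forall A B : set R, measurable A -> measurable B ->
  P (X @^-1` A `&` Y @^-1` B) = P (X @^-1` A) * P (Y @^-1` B).

(** As functions of [C] both sides are measures, given on rectangles by the law of [X] times the law
    of [Y] scaled by [P E]; the product measure is unique. Scaling, rather than conditioning on [E],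
    avoids a division by [P E]. *)
Lemma joint_law_indep_event (E : set T) : measurable E ->
    (forall A B, measurable A -> measurable B ->
      P (X @^-1` A `&` Y @^-1` B `&` E) = P (X @^-1` A) * (P (Y @^-1` B) * P E)) ->
  independent_rv ->
  forall C, measurable C -> P (pair_rv @^-1` C `&` E) = P (pair_rv @^-1` C) * P E.
Proof.
move=> mE hE hXY C mC.
have c0 : (0 <= fine (P E))%R by exact: fine_ge0.
pose c := NngNum c0.
have cE : (c%:num)%:E = P E by rewrite /= fineK// fin_num_measure.
have := @product_measure_unique _ _ _ _ _ (distribution P X)
  (mscale c (distribution P Y)) (pushforward (mrestr P mE) pair_rv) _ C mC.
move=> /(_ measurable_pair_rv) h.
rewrite -[LHS]/(pushforward (mrestr P mE) pair_rv C) -h; last first.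
  move=> A B mA mB; rewrite /pushforward/=; rewrite /mrestr/= /mscale/= -[(fine _)%:E]/((c%:num)%:E) cE.
  by rewrite (muleC (P E)); exact: hE.
rewrite (@product_measure_unique _ _ _ _ _ _ _ (mscale c (distribution P pair_rv)))//.
  by rewrite -[LHS]/((c%:num)%:E * _) cE muleC.
move=> A B mA mB; rewrite /mscale/= muleCA; congr (_ * _).
exact: hXY.
Qed.

Hypothesis XY : independent_rv.

Lemma joint_law_indep C : measurable C ->
  distribution P pair_rv C = (distribution P X \x distribution P Y) C.
Proof.
move=> mC; apply/esym; exact: product_measure_unique.
Qed.

Variables f g : R -> R.
Hypotheses (mf : measurable_fun setT f) (mg : measurable_fun setT g).
Hypotheses (intf : P.-integrable setT (EFin \o (f \o X)))
  (intg : P.-integrable setT (EFin \o (g \o Y))).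

Let fg (z : R * R) : \bar R := (f z.1 * g z.2)%:E.

Let measurable_fg : measurable_fun setT fg.
Proof.
apply/measurable_EFinP; apply: measurable_funM.
  exact: (measurableT_comp mf).
exact: (measurableT_comp mg).
Qed.

Let intf' : (distribution P X).-integrable setT (EFin \o f).
Proof.
by apply: (@integrable_pushforward _ _ _ _ _ X) => //; exact/measurable_EFinP.
Qed.

Let intg' : (distribution P Y).-integrable setT (EFin \o g).
Proof.
by apply: (@integrable_pushforward _ _ _ _ _ Y) => //; exact/measurable_EFinP.
Qed.

Let integrable_fg : (distribution P X \x distribution P Y).-integrable setT fg.
Proof.
apply/integrable12ltyP => //; rewrite /fg/=.
under eq_integral => x _.
  under eq_integral do rewrite normrM EFinM.
  rewrite ge0_integralZl//; last first.
    by apply/measurable_EFinP; exact: measurableT_comp.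
  over.
rewrite ge0_integralZr//.
- have /integrableP[_ h1] := intf'.
  have /integrableP[_ h2] := intg'.
  rewrite lte_mul_pinfty//.
  - exact: integral_ge0.
  - by rewrite ge0_fin_numE// integral_ge0.
- by apply/measurable_EFinP; exact: measurableT_comp.
- exact: integral_ge0.
Qed.

Lemma integrable_indepM : P.-integrable setT (fun w => (f (X w) * g (Y w))%:E).
Proof.
apply/integrableP; split.
  apply/measurable_EFinP; apply: measurable_funM; exact: measurableT_comp.
have /integrableP[_] := integrable_fg.
rewrite (eq_measure_integral (distribution P pair_rv)); last first.
  by move=> A mA _; exact/esym/joint_law_indep.
rewrite ge0_integral_distribution//.
by apply: measurableT_comp.
Qed.

Lemma integral_indepM :
  \int[P]_w (f (X w) * g (Y w))%:E = (\int[P]_w (f (X w))%:E) * (\int[P]_w (g (Y w))%:E).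
Proof.
transitivity (\int[distribution P pair_rv]_z fg z).
  by rewrite integral_distribution//; exact: integrable_indepM.
rewrite (eq_measure_integral (distribution P X \x distribution P Y)); last first.
  by move=> A mA _; exact: joint_law_indep.
rewrite -integral12_prod_meas1// /fubini_F /fg/=.
under eq_integral => x _.
  under eq_integral do rewrite EFinM.
  rewrite integralZl//.
  over.
have g_fin : \int[distribution P Y]_y (g y)%:E \is a fin_num by exact: integrable_fin_num.
rewrite -(fineK g_fin) integralZr//; congr (_ * _).
- by apply: (@integral_distribution _ _ _ _ _ P X (EFin \o f)) => //; exact/measurable_EFinP.
- rewrite fineK//.
  by apply: (@integral_distribution _ _ _ _ _ P Y (EFin \o g)) => //; exact/measurable_EFinP.
Qed.

Lemma Rintegral_indepM : (\int[P]_w (f (X w) * g (Y w)) =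
  (\int[P]_w (f (X w))) * (\int[P]_w (g (Y w))))%R.
Proof.
by rewrite /Rintegral integral_indepM fineM//; exact: integrable_fin_num.
Qed.

End pair.

Definition partial_sum (Y : nat -> {RV P >-> R}) n (w : T) : R := (\sum_(i < n) Y i w)%R.

Lemma measurable_partial_sum Y n : measurable_fun setT (partial_sum Y n).
Proof. by apply: measurable_sum => i; exact: measurable_funP. Qed.

HB.instance Definition _ Y n :=
  isMeasurableFun.Build _ _ _ _ (partial_sum Y n) (measurable_partial_sum Y n).

Lemma partial_sumS Y n w : partial_sum Y n.+1 w = (partial_sum Y n w + Y n w)%R.
Proof. by rewrite /partial_sum big_ord_recr. Qed.

Section partial_sum_independence.
Variable Y : nat -> {RV P >-> R}.
Hypothesis Yindep : mutually_independent P Y.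

Let cylinder (J : {fset nat}) (B : nat -> set R) := \bigcap_(i in [set` J]) Y i @^-1` B i.

Let measurable_cylinder J B : (forall i, measurable (B i)) -> measurable (cylinder J B).
Proof.
by move=> mB; apply: fin_bigcap_measurable => // i _; exact: measurable_funPTI.
Qed.

Let cylinder_fset1U n D J B : n \notin J ->
  cylinder (n |` J)%fset (fun i => if i == n then D else B i) = Y n @^-1` D `&` cylinder J B.
Proof.
move=> nJ; apply/seteqP; split=> w /=.
  move=> h; split.
    by have := h n; rewrite /= eqxx; apply; exact: fset1U1.
  move=> i /= iJ; have := h i; rewrite /= ifN; last by apply: contraNN nJ => /eqP <-.
  by apply; exact: fset1Ur.
move=> [hn hJ] i /= /fset1UP[->|iJ]; first by rewrite eqxx.
rewrite ifN; last by apply: contraNN nJ => /eqP <-.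
exact: hJ.
Qed.

Let measure_cylinder_fset1U n D J B : measurable D -> (forall i, measurable (B i)) ->
  n \notin J -> P (Y n @^-1` D `&` cylinder J B) = P (Y n @^-1` D) * P (cylinder J B).
Proof.
move=> mD mB nJ; rewrite -cylinder_fset1U//.
rewrite /cylinder !Yindep//; last by move=> i; case: ifP.
rewrite big_fsetU1//= eqxx; congr (_ * _); apply: eq_big_seq => i iJ.
by rewrite ifN//; apply: contraNN nJ => /eqP <-.
Qed.

(** Independence from the single term [Y n] is not inductive, but independence from all cylinders
    over indices at least [n] is: the next sum is a function of the pair of the current sum and
    [Y n], and an event on [Y n] joined with a cylinder over later indices is again such a
    cylinder. *)
Lemma partial_sum_indep_cylinder n A J B : measurable A -> (forall i, measurable (B i)) ->
  (forall i, i \in J -> (n <= i)%N) ->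
  P (partial_sum Y n @^-1` A `&` cylinder J B) = P (partial_sum Y n @^-1` A) * P (cylinder J B).
Proof.
elim: n A J B => [|n ih] A J B mA mB leJ.
  have -> : partial_sum Y 0 = cst 0%R.
    by apply/funext => w; rewrite /partial_sum big_ord0.
  have [A0|A0] := pselect (A 0%R).
    rewrite (_ : _ @^-1` _ = setT) ?setTI ?probability_setT ?mul1e//.
    by apply/seteqP; split.
  rewrite (_ : _ @^-1` _ = set0) ?set0I ?measure0 ?mul0e//.
  by apply/seteqP; split.
have nJ : n \notin J by apply/negP => /leJ; rewrite ltnn.
have eqS : partial_sum Y n.+1 @^-1` A =
    pair_rv (partial_sum Y n) (Y n) @^-1` ((fun z : R * R => z.1 + z.2)%R @^-1` A).
  by apply/seteqP; split => w /=; rewrite partial_sumS.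
have mC : measurable ((fun z : R * R => z.1 + z.2)%R @^-1` A).
  rewrite -[_ @^-1` _]setTI.
  by apply: (@measurable_funD _ _ R setT fst snd).
rewrite eqS; apply: joint_law_indep_event => //; first exact: measurable_cylinder.
  move=> A' D mA' mD; rewrite -setIA -measure_cylinder_fset1U// -cylinder_fset1U//.
  apply: ih => // [i|i]; first by case: ifP.
  by rewrite in_fset1U => /orP[/eqP->//|/leJ/ltnW].
move=> A' D mA' mD.
have := ih A' [fset n]%fset (fun=> D) mA' (fun=> mD).
rewrite /cylinder (_ : \bigcap_(i in _) _ = Y n @^-1` D); last first.
  apply/seteqP; split => w /=; first by apply; rewrite /= fset11.
  by move=> h i /= /fset1P ->.
by apply => i /fset1P ->.
Qed.

Lemma partial_sum_indep n : independent_rv (partial_sum Y n) (Y n).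
Proof.
move=> A D mA mD; have := @partial_sum_indep_cylinder n A [fset n]%fset (fun=> D) mA (fun=> mD).
rewrite /cylinder (_ : \bigcap_(i in _) _ = Y n @^-1` D); last first.
  apply/seteqP; split => w /=; first by apply; rewrite /= fset11.
  by move=> h i /= /fset1P ->.
by apply => i /fset1P ->.
Qed.

End partial_sum_independence.
End independence.

(** * Characteristic functions and moments of partial sums *)

Section characteristic_function.
Context d (T : measurableType d) (R : realType) (P : probability T R).
Implicit Types X Y : {RV P >-> R}.

Lemma integrable_le1 (f : T -> R) : measurable_fun setT f ->
  (forall w, `|f w| <= 1) -> P.-integrable setT (EFin \o f).
Proof.
move=> mf f1; apply: measurable_bounded_integrable => //.
  by rewrite (le_lt_trans (probability_le1 P measurableT))// ltry.
by exists 1; split => // M M1 w _; exact: (le_trans (f1 w) (ltW M1)).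
Qed.

Lemma integrable_cst_probability (r : R) : P.-integrable setT (EFin \o (fun _ : T => r)).
Proof.
apply: measurable_bounded_integrable => //; last exact: bounded_cst.
by rewrite (le_lt_trans (probability_le1 P measurableT))// ltry.
Qed.

Lemma Rintegral_cst_probability (r : R) : \int[P]_w r = r.
Proof.
by rewrite Rintegral_cst// -[RHS]mulr1; congr (_ * _); rewrite -[RHS]/(fine 1%E) -(probability_setT P).
Qed.

Lemma Rintegral_le1 (f : T -> R) : measurable_fun setT f ->
  (forall w, `|f w| <= 1) -> `|\int[P]_w f w| <= 1.
Proof.
move=> mf f1; apply: (le_trans (le_normr_Rintegral measurableT (integrable_le1 mf f1))).
have -> : 1 = \int[P]_w 1 :> R.
  by rewrite Rintegral_cst_probability.
apply: le_Rintegral => //; apply: integrable_le1 => //.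
- exact: measurableT_comp.
- by move=> w; rewrite normr_id.
- by move=> w; rewrite normr1.
Qed.

Definition cf_re X t := \int[P]_w cos (t * X w).
Definition cf_im X t := \int[P]_w sin (t * X w).

Lemma measurable_cosX X t : measurable_fun setT (fun w => cos (t * X w)).
Proof.
apply: (@measurableT_comp _ _ _ _ _ _ (@cos R)).
  by apply: continuous_measurable_fun; exact: continuous_cos.
exact: measurable_funM.
Qed.

Lemma measurable_sinX X t : measurable_fun setT (fun w => sin (t * X w)).
Proof.
apply: (@measurableT_comp _ _ _ _ _ _ (@sin R)).
  by apply: continuous_measurable_fun; exact: continuous_sin.
exact: measurable_funM.
Qed.

Lemma integrable_cosX X t : P.-integrable setT (EFin \o (fun w => cos (t * X w))).
Proof. by apply: integrable_le1 => [|w]; [exact: measurable_cosX|exact: cos_max]. Qed.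

Lemma integrable_sinX X t : P.-integrable setT (EFin \o (fun w => sin (t * X w))).
Proof. by apply: integrable_le1 => [|w]; [exact: measurable_sinX|exact: sin_max]. Qed.

Lemma normr_cf_re_le1 X t : `|cf_re X t| <= 1.
Proof. by apply: Rintegral_le1 => [|w]; [exact: measurable_cosX|exact: cos_max]. Qed.

Lemma normr_cf_im_le1 X t : `|cf_im X t| <= 1.
Proof. by apply: Rintegral_le1 => [|w]; [exact: measurable_sinX|exact: sin_max]. Qed.

Lemma integrableZlR (f : T -> R) (k : R) : P.-integrable setT (EFin \o f) ->
  P.-integrable setT (EFin \o (fun w => k * f w)).
Proof. by move=> f1; rewrite /comp; under eq_fun do rewrite EFinM; exact: integrableZl. Qed.

Lemma integrableDR (f g : T -> R) : P.-integrable setT (EFin \o f) ->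
  P.-integrable setT (EFin \o g) -> P.-integrable setT (EFin \o (fun w => f w + g w)).
Proof.
by move=> f1 g1; rewrite /comp; under eq_fun do rewrite EFinD; exact: integrableD.
Qed.

Lemma integrableBR (f g : T -> R) : P.-integrable setT (EFin \o f) ->
  P.-integrable setT (EFin \o g) -> P.-integrable setT (EFin \o (fun w => f w - g w)).
Proof.
by move=> f1 g1; rewrite /comp; under eq_fun do rewrite EFinB; exact: integrableB.
Qed.

(** This is the real part of [E exp(i t (X - y))], the kernel of both Fourier inversion and the
    bound by atoms. *)
Lemma cf_shift X t y :
  \int[P]_w cos (t * (X w - y)) = cf_re X t * cos (t * y) + cf_im X t * sin (t * y).
Proof.
under eq_Rintegral do rewrite mulrBr cosB.
rewrite RintegralD//; first 1 last.
- by rewrite /comp; under eq_fun do rewrite mulrC; apply: integrableZlR; exact: integrable_cosX.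
- by rewrite /comp; under eq_fun do rewrite mulrC; apply: integrableZlR; exact: integrable_sinX.
by rewrite !RintegralZr//; [exact: integrable_sinX|exact: integrable_cosX].
Qed.

Lemma ident_Rintegral X Y (f : R -> R) : measurable_fun setT f ->
  (forall B, measurable B -> distribution P X B = distribution P Y B) ->
  P.-integrable setT (EFin \o (f \o X)) -> P.-integrable setT (EFin \o (f \o Y)) /\
  \int[P]_w f (X w) = \int[P]_w f (Y w).
Proof.
move=> mf XY iX; have mf' : measurable_fun setT (EFin \o f) by exact/measurable_EFinP.
have iY : P.-integrable setT (EFin \o (f \o Y)).
  apply/integrableP; split.
    by apply/measurable_EFinP; exact: measurableT_comp.
  have /integrableP[_] := iX; congr (_ < _)%E.
  have mf1 : measurable_fun setT (abse \o (EFin \o f)) by exact: measurableT_comp.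
  have f0 y : (0 <= (abse \o (EFin \o f)) y)%E by exact: abse_ge0.
  rewrite -[LHS](ge0_integral_distribution X mf1 f0).
  rewrite -[RHS](ge0_integral_distribution Y mf1 f0).
  by apply: eq_measure_integral => A mA _; exact: XY.
split => //; rewrite /Rintegral; congr fine.
rewrite -[LHS](@integral_distribution _ _ _ _ _ P X (EFin \o f))//.
rewrite -[RHS](@integral_distribution _ _ _ _ _ P Y (EFin \o f))//.
by apply: eq_measure_integral => A mA _; exact: XY.
Qed.

Section sums.
Variable Y : nat -> {RV P >-> R}.
Hypothesis Yindep : mutually_independent P Y.
Hypothesis Yident : identically_distributed P Y.
Let S := partial_sum Y.
Variable t : R.
Let c := cf_re (Y 0%N) t.
Let s := cf_im (Y 0%N) t.

Let mcos : measurable_fun setT (fun x : R => cos (t * x)).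
Proof. by under eq_fun do rewrite mulrC; exact: measurable_cosM. Qed.

Let msin : measurable_fun setT (fun x : R => sin (t * x)).
Proof. by under eq_fun do rewrite mulrC; exact: measurable_sinM. Qed.

Let cE n : cf_re (Y n) t = c.
Proof.
by have [_] := @ident_Rintegral (Y n) (Y 0) (fun x => cos (t * x))
  mcos (fun B mB => Yident n 0 mB) (integrable_cosX _ _).
Qed.

Let sE n : cf_im (Y n) t = s.
Proof.
by have [_] := @ident_Rintegral (Y n) (Y 0) (fun x => sin (t * x))
  msin (fun B mB => Yident n 0 mB) (integrable_sinX _ _).
Qed.

(** With [cf_im_sumS], this is multiplication by the complex number [c + i s] in coordinates, so
    that [cf_sum_norm] is multiplicativity of the squared modulus. *)
Lemma cf_re_sumS n : cf_re (S n.+1) t = cf_re (S n) t * c - cf_im (S n) t * s.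
Proof.
rewrite /cf_re -(cE n) -(sE n).
under eq_Rintegral do rewrite /= partial_sumS mulrDr cosD.
have mc := mcos; have ms := msin.
have h := partial_sum_indep Yindep n.
rewrite RintegralB//.
- rewrite (Rintegral_indepM h mc mc); [|exact: integrable_cosX..].
  by rewrite (Rintegral_indepM h ms ms); [|exact: integrable_sinX..].
- by apply: (integrable_indepM h mc mc); exact: integrable_cosX.
- by apply: (integrable_indepM h ms ms); exact: integrable_sinX.
Qed.

Lemma cf_im_sumS n : cf_im (S n.+1) t = cf_im (S n) t * c + cf_re (S n) t * s.
Proof.
rewrite /cf_im -(cE n) -(sE n).
under eq_Rintegral do rewrite /= partial_sumS mulrDr sinD.
have mc := mcos; have ms := msin.
have h := partial_sum_indep Yindep n.
rewrite RintegralD//.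
- rewrite (Rintegral_indepM h ms mc); [|exact: integrable_sinX|exact: integrable_cosX].
  by rewrite (Rintegral_indepM h mc ms); [|exact: integrable_cosX|exact: integrable_sinX].
- by apply: (integrable_indepM h ms mc); [exact: integrable_sinX|exact: integrable_cosX].
- by apply: (integrable_indepM h mc ms); [exact: integrable_cosX|exact: integrable_sinX].
Qed.

Lemma cf_re_sum0 : cf_re (S 0) t = 1.
Proof.
rewrite /cf_re -[RHS](_ : \int[P]_w 1 = _).
  by apply: eq_Rintegral => w _; rewrite /S/= /partial_sum big_ord0 mulr0 cos0.
by rewrite Rintegral_cst_probability.
Qed.

Lemma cf_im_sum0 : cf_im (S 0) t = 0.
Proof.
rewrite /cf_im -[RHS](_ : \int[P]_w 0 = _).
  by apply: eq_Rintegral => w _; rewrite /S/= /partial_sum big_ord0 mulr0 sin0.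
by rewrite Rintegral_cst// mul0r.
Qed.

Lemma cf_sum_norm n : cf_re (S n) t ^+ 2 + cf_im (S n) t ^+ 2 = (c ^+ 2 + s ^+ 2) ^+ n.
Proof.
elim: n => [|n ih]; first by rewrite cf_re_sum0 cf_im_sum0 expr0n expr1n addr0.
by rewrite [RHS]exprSr -ih cf_re_sumS cf_im_sumS; ring.
Qed.

(** Telescoping, as for [|z ^ n - b ^ n| <= n |z - b|] in the unit disc: each step adds at most
    [|c - b| + |s|] to each of the two coordinates, whence the factor 2. *)
Lemma cf_sum_dist n b : 0 <= b <= 1 ->
  `|cf_re (S n) t - b ^+ n| + `|cf_im (S n) t| <= 2 * n%:R * (`|c - b| + `|s|).
Proof.
move=> /andP[b0 b1]; elim: n => [|n ih].
  by rewrite cf_re_sum0 cf_im_sum0 subrr !normr0 addr0 mulr0 mul0r.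
have h1 : `|cf_re (S n.+1) t - b ^+ n.+1| <=
    `|cf_re (S n) t - b ^+ n| + `|c - b| + `|s|.
  have -> : cf_re (S n.+1) t - b ^+ n.+1 = (cf_re (S n) t - b ^+ n) * b +
      cf_re (S n) t * (c - b) - cf_im (S n) t * s.
    by rewrite cf_re_sumS exprSr; ring.
  rewrite (le_trans (ler_normB _ _))// lerD//; last first.
    by rewrite normrM ler_piMl// normr_cf_im_le1.
  rewrite (le_trans (ler_normD _ _))// lerD//.
    by rewrite normrM (ger0_norm b0) ler_piMr.
  by rewrite normrM ler_piMl// normr_cf_re_le1.
have h2 : `|cf_im (S n.+1) t| <= `|cf_im (S n) t| + `|c - b| + `|s|.
  have -> : cf_im (S n.+1) t = cf_im (S n) t * b + cf_im (S n) t * (c - b) +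
      cf_re (S n) t * s by rewrite cf_im_sumS; ring.
  rewrite (le_trans (ler_normD _ _))// lerD//; last first.
    by rewrite normrM ler_piMl// normr_cf_re_le1.
  rewrite (le_trans (ler_normD _ _))// lerD//.
    by rewrite normrM (ger0_norm b0) ler_piMr.
  by rewrite normrM ler_piMl// normr_cf_im_le1.
rewrite (le_trans (lerD h1 h2))//.
by rewrite -natr1; lra.
Qed.

End sums.

Section moments.
Variable Y : nat -> {RV P >-> R}.
Hypothesis Yindep : mutually_independent P Y.
Hypothesis Yident : identically_distributed P Y.
Hypothesis Y2 : P.-integrable setT (EFin \o (fun w => Y 0%N w ^+ 2)).
Hypothesis Y1 : \int[P]_w Y 0%N w = 0.
Let v := \int[P]_w Y 0%N w ^+ 2.

Lemma integrable_sqr_integrable X :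
  P.-integrable setT (EFin \o (fun w => X w ^+ 2)) -> P.-integrable setT (EFin \o X).
Proof.
move=> X2; have i1 := integrable_cst_probability 1.
apply: le_integrable (integrableDR i1 X2) => //; first exact/measurable_EFinP.
move=> w _; rewrite lee_fin [leRHS]ger0_norm; last by rewrite addr_ge0// sqr_ge0.
rewrite -[X w ^+ 2]real_normK ?num_real//; have := sqr_ge0 (`|X w| - 1).
by have := normr_ge0 (X w); lra.
Qed.

(** The cross term [2 S_n Y_n] of the square integrates to 0 by independence and centring. *)
Lemma partial_sum_moments n :
  [/\ P.-integrable setT (EFin \o (fun w => partial_sum Y n w ^+ 2)),
      \int[P]_w partial_sum Y n w = 0 &
      \int[P]_w partial_sum Y n w ^+ 2 = n%:R * v].
Proof.
have m2 : measurable_fun setT (fun x : R => x ^+ 2) by exact: measurable_funX.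
elim: n => [|n [i2 e1 e2]].
  have e w : partial_sum Y 0 w = 0 by rewrite /partial_sum big_ord0.
  split.
  - rewrite /comp; under eq_fun do rewrite e expr0n/=.
    exact: integrable0.
  - by under eq_Rintegral do rewrite e; rewrite Rintegral_cst// mul0r.
  - by under eq_Rintegral do rewrite e expr0n/=; rewrite Rintegral_cst// !mul0r.
have i1 := integrable_sqr_integrable i2.
have [iY2 eY2] := ident_Rintegral m2 (fun B mB => Yident 0 n mB) Y2.
have iY1 := integrable_sqr_integrable iY2.
have [_ eY1] := ident_Rintegral (@measurable_id _ _ _) (fun B mB => Yident n 0 mB) iY1.
have h := partial_sum_indep Yindep n.
have iSY : P.-integrable setT (EFin \o (fun w => partial_sum Y n w * Y n w)).
  exact: (integrable_indepM h (@measurable_id _ _ _) (@measurable_id _ _ _)).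
have eSY : \int[P]_w (partial_sum Y n w * Y n w) = 0.
  rewrite (Rintegral_indepM h (@measurable_id _ _ _) (@measurable_id _ _ _))//.
  by rewrite e1 mul0r.
have E w : partial_sum Y n.+1 w ^+ 2 =
    (partial_sum Y n w ^+ 2 + 2 * (partial_sum Y n w * Y n w)) + Y n w ^+ 2.
  by rewrite partial_sumS; ring.
split.
- rewrite /comp; under eq_fun do rewrite E.
  by apply: integrableDR => //; apply: integrableDR => //; exact: integrableZlR.
- under eq_Rintegral do rewrite partial_sumS.
  by rewrite RintegralD// e1 add0r; rewrite /= in eY1; rewrite eY1.
- under eq_Rintegral do rewrite E.
  rewrite RintegralD//; last by apply: integrableDR => //; exact: integrableZlR.
  rewrite RintegralD//; last exact: integrableZlR.
  by rewrite RintegralZl// e2 eSY -eY2 mulr0 addr0 -natr1 mulrDl mul1r.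
Qed.

End moments.
End characteristic_function.

Arguments cf_re {d T R} P X t.
Arguments cf_im {d T R} P X t.

Section lattice_sets.
Variable R : realType.

Lemma countable_lattice (a h : R) : countable (lattice a h).
Proof. exact: (sub_countable (card_image_le _ _)). Qed.

Lemma measurable_lattice (a h : R) : measurable (lattice a h).
Proof.
apply: countable_measurable; last exact: countable_lattice.
by move=> r; exact: measurable_set1.
Qed.

End lattice_sets.

(** * Fourier inversion on a lattice *)

Section fourier_inversion.
Context d (T : measurableType d) (R : realType) (P : probability T R).
Notation mu := (@lebesgue_measure R).

Lemma sin_pi_int (k : int) : sin (k%:~R * pi) = 0 :> R.
Proof.
have nat_case (n : nat) : sin (n%:R * pi) = 0 :> R.
  elim: n => [|n ih]; first by rewrite mul0r sin0.
  by rewrite -natr1 mulrDl mul1r sinDpi ih oppr0.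
case: k => n; first by rewrite -[_%:~R]/(n%:R).
by rewrite NegzE mulrNz mulNr sinN -[_%:~R]/(n.+1%:R) nat_case oppr0.
Qed.

(** Orthogonality of characters over one period: for [k != 0] the primitive is a multiple of a sine
    whose argument at both ends is an integer multiple of [pi]. *)
Lemma integral_cos_lattice (h : R) (k : int) : 0 < h ->
  (\int[mu]_(u in `[(- (pi / h))%R, (pi / h)%R]) (cos (u * (k%:~R * h)))%:E =
   (if k == 0 then 2 * pi / h else 0)%:E)%E.
Proof.
move=> h0; have pih : 0 < pi / h by rewrite divr_gt0// pi_gt0.
have lt : - (pi / h) < pi / h by rewrite gtrN.
have [->|k0] := eqVneq k 0.
  under eq_integral do rewrite mul0r mulr0 cos0.
  rewrite integral_cst//= lebesgue_measure_itv/= lte_fin lt mul1e.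
  by rewrite opprK -EFinD; congr (_%:E); lra.
have k1 : k%:~R * h != 0 by rewrite mulf_neq0 ?intr_eq0// gt_eqF.
set x := k%:~R * h in k1 *.
have dF (u : R) : is_derive u 1 (fun u : R => x^-1 * sin (u * x)) (cos (u * x)).
  have h1 : is_derive u 1 (x \*: (@id R)) _ := is_deriveZ x (is_derive_id u 1).
  have := is_deriveZ x^-1 (is_derive1_comp (is_derive_sin _) h1).
  have -> : x^-1 \*: (sin \o (x \*: (@id R))) = (fun u : R => x^-1 * sin (u * x)).
    by apply/funext => y /=; rewrite (mulrC y).
  have -> : (x \*: (@id R)) u = u * x by rewrite /= /GRing.scale/= mulrC.
  by move=> h'; apply: (is_derive_eq h'); rewrite /GRing.scale/= mulr1 mulrCA mulVf ?mulr1.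
rewrite (@integral_is_derive _ _ _ _ _ lt _ dF); last exact: continuous_cosM.
rewrite mulNr sinN.
have -> : pi / h * x = k%:~R * pi by rewrite /x; field; rewrite gt_eqF.
by rewrite sin_pi_int oppr0 mulr0 subr0.
Qed.

Variables (X : {RV P >-> R}) (a h : R).
Hypothesis h0 : 0 < h.
Hypothesis Xlattice : P (X @^-1` lattice a h) = 1%E.

Lemma ae_lattice : {ae P, forall w, lattice a h (X w)}.
Proof.
have mA : measurable (X @^-1` lattice a h).
  by apply: measurable_funPTI; exact: measurable_lattice.
exists (~` (X @^-1` lattice a h)); split => //; first exact: measurableC.
rewrite -[LHS]/(P _) probability_setC// Xlattice.
by rewrite subee.
Qed.

(** Fubini for the kernel [cos (u (X - x))] over [[- pi / h, pi / h]]: integrating over the sample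
    space first gives the characteristic function, integrating over [u] first gives [2 pi / h] times
    the indicator of [X = x]. *)
Lemma fourier_inversion_lattice x : lattice a h x ->
  2 * pi / h * pmf X x = \int[mu]_(u in `[- (pi / h), pi / h])
    (cf_re P X u * cos (u * x) + cf_im P X u * sin (u * x)).
Proof.
move=> [k0 _ xE].
pose D : set R := `[- (pi / h), pi / h]%classic.
pose f (z : R * T) := \1_D z.1 * cos (z.1 * (X z.2 - x)).
have mf : measurable_fun setT (EFin \o f).
  apply/measurable_EFinP; apply: measurable_funM.
    have m1D : measurable_fun setT (\1_D : R -> R) by apply: measurable_indic; exact: measurable_itv.
    exact: (measurableT_comp m1D measurable_fst).
  apply: (@measurableT_comp _ _ _ _ _ _ (@cos R)).
    by apply: continuous_measurable_fun; exact: continuous_cos.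
  apply: measurable_funM => //.
  by apply: measurable_funB => //; apply: measurableT_comp => //; exact: measurable_snd.
have mcos u : measurable_fun setT (fun w => cos (u * (X w - x))).
  apply: (@measurableT_comp _ _ _ _ _ _ (@cos R)).
    by apply: continuous_measurable_fun; exact: continuous_cos.
  by apply: measurable_funM => //; exact: measurable_funB.
have intf : (mu \x P)%E.-integrable setT (EFin \o f).
  apply/integrable12ltyP => //.
  apply: (@le_lt_trans _ _ (\int[mu]_u (\1_D u)%:E)%E).
    apply: ge0_le_integral => //.
    - by move=> u _; exact: integral_ge0.
    - apply: (@measurable_fun_fubini_tonelli_F _ _ _ _ _ P (abse \o (EFin \o f))) => //.
        exact: measurableT_comp.
      by move=> z; exact: abse_ge0.
    - by apply/measurable_EFinP; apply: measurable_indic; exact: measurable_itv.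
    move=> u _; apply: (@le_trans _ _ (\int[P]_w (\1_D u)%:E)%E).
      apply: ge0_le_integral => //.
      - apply: measurableT_comp => //; apply/measurable_EFinP; rewrite /f/=.
        by apply: measurable_funM => //; exact: mcos.
      move=> w _; rewrite /= lee_fin normrM ger0_norm// ler_piMr// cos_max//.
    rewrite integral_cst//.
    have -> : (P : {measure set T -> \bar R}) setT = 1%E := probability_setT P.
    by rewrite mule1.
  rewrite integral_indic//; last exact: measurable_itv.
  rewrite /= setIT /D lebesgue_measure_itv/=.
  by case: ifP => // _; rewrite -EFinB ltry.
have inner1 u : (\int[P]_w (EFin \o f) (u, w) =
    (\1_D u * (cf_re P X u * cos (u * x) + cf_im P X u * sin (u * x)))%:E)%E.
  rewrite -cf_shift /f/=.
  have ic : P.-integrable setT (EFin \o (fun w => cos (u * (X w - x)))).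
    by apply: integrable_le1 => [|w]; [exact: mcos|exact: cos_max].
  under eq_integral do rewrite EFinM.
  rewrite integralZl// EFinM; congr (_ * _)%E.
  by rewrite /Rintegral fineK//; exact: integrable_fin_num.
have inner2 w : lattice a h (X w) -> (\int[mu]_u (EFin \o f) (u, w) =
    (2 * pi / h * \1_[set x] (X w))%:E)%E.
  move=> [k _ XE].
  have -> : (\int[mu]_u (EFin \o f) (u, w) =
      \int[mu]_(u in D) (cos (u * ((k - k0)%:~R * h)))%:E)%E.
    rewrite [RHS]integral_mkcond; apply: eq_integral => u _; rewrite patchE /f/= indicE.
    rewrite -XE -xE; case: ifP => _; rewrite ?mul0r// mul1r; congr (cos _)%:E.
    by rewrite intrB; ring.
  rewrite integral_cos_lattice//; congr (_%:E).
  rewrite subr_eq0 indicE; have [kk|kk] := eqVneq k k0.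
    by rewrite mem_set ?mulr1// /= -XE -xE kk.
  rewrite memNset ?mulr0//= -XE -xE => /addrI/mulIf e.
  by move/eqP: kk; apply; apply/eqP; rewrite -(eqr_int R) e// gt_eqF.
have E1 : (\int[mu]_(u in D) (cf_re P X u * cos (u * x) + cf_im P X u * sin (u * x))%:E =
    \int[P]_w \int[mu]_u (EFin \o f) (u, w))%E.
  rewrite -[RHS](Fubini intf) integral_mkcond; apply: eq_integral => u _.
  by rewrite inner1 patchE indicE; case: ifP => _ /=; rewrite ?mul1r// mul0r.
rewrite [RHS]/Rintegral E1.
have cE : (fun w => (2 * pi / h * \1_[set x] (X w))%:E) =
    (fun w => (2 * pi / h)%:E * (\1_(X @^-1` [set x]) w)%:E)%E.
  by apply/funext => w; rewrite EFinM.
have mx : measurable (X @^-1` [set x]) by exact: measurable_funPTI.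
(* The inner integral over [u] is known only where [X] takes a lattice value, hence the passage
   through almost everywhere equality. *)
rewrite (ae_eq_integral (fun w => (2 * pi / h * \1_[set x] (X w))%:E))//.
- rewrite cE integralZl//; last first.
    by apply: integrable_indic => //; rewrite (le_lt_trans (probability_le1 P mx))// ltry.
  by rewrite integral_indic// setIT fineM// fin_num_measure.
- exact: (measurable_fubini_G intf).
- rewrite cE; apply: measurable_funeM.
  by apply/measurable_EFinP; exact: measurable_indic.
- by apply: filterS ae_lattice => w Xw _; exact: inner2.
Qed.

End fourier_inversion.

(** * Subgroups of the integers, supports and atoms *)

Section integer_subgroups.

Lemma int_subgroup_principal (G : int -> Prop) : G 0 -> (forall x y, G x -> G y -> G (x - y)) ->
  exists2 g : nat, G g%:Z & forall d, G d -> (g %| d)%Z.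
Proof.
move=> G0 GB.
have GN x : G x -> G (- x) by move=> Gx; rewrite -sub0r; exact: GB.
have GD x y : G x -> G y -> G (x + y).
  by move=> Gx Gy; rewrite -[y]opprK; apply: GB => //; exact: GN.
have Gnat x (n : nat) : G x -> G (x * n%:Z).
  move=> Gx; elim: n => [|n ih]; first by rewrite mulr0.
  by rewrite intS mulrDr mulr1; exact: GD.
have Gmul x k : G x -> G (x * k).
  move=> Gx; case: k => n; first exact: Gnat.
  by rewrite NegzE mulrN; apply: GN; exact: Gnat.
have Gabs x : G x -> G `|x|%N%:Z.
  by move=> Gx; rewrite abszE; case: ger0P => // _; exact: GN.
have [[n0 Gn0]|noG] := pselect (exists n : nat, `[< (0 < n)%N /\ G n%:Z >]).
  have exG : exists n, `[< (0 < n)%N /\ G n%:Z >] by exists n0.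
  case: (ex_minnP exG) => g /asboolP[g0 Gg] gmin.
  exists g => // d Gd.
  have Gr : G (d %% g)%Z.
    have -> : (d %% g)%Z = d - g%:Z * (d %/ g)%Z.
      by rewrite mulrC.
    by apply: GB => //; exact: Gmul.
  have r0 : (0 <= d %% g)%Z by rewrite modz_ge0// eqz_nat -lt0n.
  have rg : (d %% g < g)%Z by rewrite ltz_pmod// ltz_nat.
  apply/dvdz_mod0P; move: Gr r0 rg; case: (d %% g)%Z => // r Gr _ rg.
  case: r Gr rg => // r Gr rg.
  have := gmin r.+1 (asboolT (conj (ltn0Sn r) Gr)).
  by rewrite leqNgt -ltz_nat rg.
(* Without a positive element the subgroup is trivial, and its generator is 0, which divides only
   0. *)
exists 0%N => // d Gd; apply: contrapT => d0; apply: noG; exists `|d|%N.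
apply/asboolP; split; last exact: Gabs.
by rewrite absz_gt0; apply: contra_notN d0 => /eqP ->.
Qed.

End integer_subgroups.

Section support.
Context d (T : measurableType d) (R : realType) (P : probability T R).
Implicit Types X : {RV P >-> R}.

(** A point outside the support has a null open neighbourhood, hence lies in a null interval with
    rational ends; these are countably many, enumerated here by [choice.unpickle]. *)
Lemma negligible_notin_support X A : support_of P X `<=` A ->
  P.-negligible (X @^-1` (~` A)).
Proof.
move=> XA.
pose I (pq : rat * rat) : set R := `]ratr pq.1, ratr pq.2[%classic.
pose F (n : nat) : set T := oapp (fun pq =>
  if P (X @^-1` I pq) == 0%E then X @^-1` I pq else set0) set0 (choice.unpickle n).
apply: (negligibleS (A := \bigcup_n F n)); last first.
  apply: negligible_bigcup => n; rewrite /F; case: (choice.unpickle n) => [pq|]/=; last exact: negligible_set0.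
  case: ifP => [/eqP PI|_]; last exact: negligible_set0.
  by apply/negligibleP => //; apply: measurable_funPTI; exact: measurable_itv.
move=> w nA; have : ~ support_of P X (X w) by move=> /XA.
move=> /existsNP[U] /not_implyP[[oU Uw] /negP].
rewrite -leNgt => PU.
have mI pq : measurable (X @^-1` I pq).
  by apply: measurable_funPTI; exact: measurable_itv.
have [e eU] := nbhs_ex (open_nbhs_nbhs (conj oU Uw)).
have e0 : 0 < e%:num by [].
have [p] : exists p : rat, ratr p \in `](X w - e%:num), (X w)[.
  by apply: rat_in_itvoo; rewrite ltrBlDr ltrDl.
have [q] : exists q : rat, ratr q \in `](X w), (X w + e%:num)[.
  by apply: rat_in_itvoo; rewrite ltrDl.
rewrite !in_itv/= => /andP[q1 q2] /andP[p1 p2].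
exists (choice.pickle (p, q)); [by []|rewrite /F choice.pickleK/= ifT].
  by rewrite /I/= in_itv/= p2.
rewrite eq_le measure_ge0 andbT (le_trans _ PU)// le_measure ?inE//.
  by rewrite -[_ @^-1` _]setTI; apply: measurable_funP => //; exact: open_measurable.
move=> w'; rewrite /I/= in_itv/= => /andP[h1 h2]; apply: eU.
by rewrite -ball_normE/= ltr_norml; apply/andP; split; lra.
Qed.

(** Off the lattice, [Num.floor] finds the open gap around [x], which is null. A larger span will be
    certified this way from an almost sure statement. *)
Lemma lattice_support X a h : 0 < h -> P (X @^-1` lattice a h) = 1%E ->
  support_of P X `<=` lattice a h.
Proof.
move=> h0 PX x suppx; apply: contrapT => nlx.
pose k := Num.floor ((x - a) / h).
have /andP[kl kr] := floor_itv ((x - a) / h).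
rewrite -/k ler_pdivlMr// in kl; rewrite -/k ltr_pdivrMr// intrD in kr.
have Ux : open_nbhs x `]a + k%:~R * h, a + (k + 1)%:~R * h[%classic.
  split; first exact: itv_open.
  rewrite /= in_itv/= intrD; apply/andP; split; last by lra.
  rewrite lt_neqAle; apply/andP; split; last by lra.
  by apply/eqP => e; apply: nlx; exists k.
have := suppx _ Ux; rewrite ltNge => /negP; apply.
have mlat : measurable (X @^-1` lattice a h).
  by apply: measurable_funPTI; exact: measurable_lattice.
apply: (@le_trans _ _ (P (~` (X @^-1` lattice a h)))).
  apply: le_measure; rewrite ?inE.
  - by apply: measurable_funPTI; exact: measurable_itv.
  - exact: measurableC.
  move=> w /= + [j _ e]; rewrite -e in_itv/= => /andP[].
  rewrite !ltrD2l !ltr_pM2r// !ltr_int => h1 h2.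
  by move: h2; rewrite ltzD1 leNgt h1.
by rewrite probability_setC// PX subee.
Qed.

(** The lattice is countable, so its points of mass zero are negligible together. This restricts
    attention to atoms, whose differences are known to lie in the subgroup [G] below. *)
Lemma atom_exists_ae X a h : P (X @^-1` lattice a h) = 1%E ->
  P.-negligible [set w | ~ exists2 k : int, X w = a + k%:~R * h & (0 < pmf X (a + k%:~R * h))%R].
Proof.
move=> PX.
have mlat : measurable (X @^-1` lattice a h).
  by apply: measurable_funPTI; exact: measurable_lattice.
pose F (n : nat) : set T := oapp (fun k : int =>
  if pmf X (a + k%:~R * h) == 0 then X @^-1` [set a + k%:~R * h] else set0) set0 (choice.unpickle n).
apply: (negligibleS (A := ~` (X @^-1` lattice a h) `|` \bigcup_n F n)); last first.
  apply: negligibleU.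
    apply/negligibleP; first exact: measurableC.
    by rewrite [LHS]probability_setC// PX subee.
  apply: negligible_bigcup => n; rewrite /F; case: (choice.unpickle n) => [k|]/=; last exact: negligible_set0.
  case: ifP => [/eqP PI|_]; last exact: negligible_set0.
  have mX : measurable (X @^-1` [set a + k%:~R * h]) by exact: measurable_funPTI.
  by apply/negligibleP => //; rewrite -[LHS]fineK ?fin_num_measure// -[fine _]/(pmf _ _) PI.
move=> w nk; have [[k _ e]|nl] := pselect (lattice a h (X w)); last by left.
right; exists (choice.pickle k); [by []|rewrite /F choice.pickleK/= ifT//].
rewrite eq_le pmf_ge0 andbT leNgt; apply/negP => p0; apply: nk.
by exists k.
Qed.

Lemma atom_exists X a h : P (X @^-1` lattice a h) = 1%E ->
  exists k : int, 0 < pmf X (a + k%:~R * h).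
Proof.
move=> PX; apply: contrapT => nk.
have := atom_exists_ae PX; rewrite (_ : [set w | _] = setT); last first.
  by apply/seteqP; split => // w _ [k _ k0]; apply: nk; exists k.
move=> /(measure_negligible measurableT) => H.
by have := probability_setT P; rewrite H => /esym/eqP; rewrite onee_eq0.
Qed.

Lemma Rintegral_ge_atom X (f : R -> R) y : measurable_fun setT f -> (forall x, 0 <= f x) ->
  P.-integrable setT (EFin \o (f \o X)) -> pmf X y * f y <= \int[P]_w f (X w).
Proof.
move=> mf f0 fi; have my : measurable (X @^-1` [set y]) by exact: measurable_funPTI.
have -> : pmf X y * f y = \int[P]_(w in X @^-1` [set y]) f (X w).
  rewrite -[LHS]mulrC -Rintegral_cst//; apply: eq_Rintegral => w; rewrite inE/= => <-//.
rewrite [leLHS]Rintegral_mkcond; apply: le_Rintegral => //.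
  have -> : EFin \o ((fun w => f (X w)) \_ (X @^-1` [set y])) = (EFin \o (f \o X)) \_ (X @^-1` [set y]).
    by rewrite restrict_EFin.
  by apply/(integrable_mkcond _ my); exact: integrableS fi.
by move=> w _; rewrite patchE; case: ifP.
Qed.

(* [1 - |phi t|^2] is the expectation of [1 - g X] below, and both [1 - g X]
   and [1 - g y0] are expectations of nonnegative functions. *)
Lemma cf_norm_le_atoms X y0 y1 t :
  pmf X y0 * pmf X y1 * (1 - cos (t * (y1 - y0))) <=
  1 - (cf_re P X t ^+ 2 + cf_im P X t ^+ 2).
Proof.
set c := cf_re P X t; set s := cf_im P X t.
pose g y := c * cos (t * y) + s * sin (t * y).
have mcos y : measurable_fun setT (fun x : R => cos (t * (x - y))).
  apply: (@measurableT_comp _ _ _ _ _ _ (@cos R)).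
    by apply: continuous_measurable_fun; exact: continuous_cos.
  by apply: measurable_funM => //; exact: measurable_funB.
have icos y : P.-integrable setT (EFin \o (fun w => cos (t * (X w - y)))).
  apply: integrable_le1; first exact: (measurableT_comp (mcos y)).
  by move=> w; exact: cos_max.
have i1 := integrable_cst_probability P (1 : R).
have gE y : 1 - g y = \int[P]_w (1 - cos (t * (X w - y))).
  by rewrite RintegralB// Rintegral_cst_probability cf_shift.
have g1 y : 0 <= 1 - g y.
  by rewrite gE; apply: Rintegral_ge0 => w _; rewrite subr_ge0 cos_le1.
have h1 : pmf X y1 * (1 - cos (t * (y1 - y0))) <= 1 - g y0.
  rewrite gE; apply: (@Rintegral_ge_atom _ (fun x => 1 - cos (t * (x - y0)))).
  - exact: measurable_funB.
  - by move=> x; rewrite subr_ge0 cos_le1.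
  - exact: integrableBR.
have mg : measurable_fun setT g.
  apply: measurable_funD; apply: measurable_funM => //.
    by under eq_fun do rewrite mulrC; exact: measurable_cosM.
  by under eq_fun do rewrite mulrC; exact: measurable_sinM.
have ig : P.-integrable setT (EFin \o (g \o X)).
  by apply: integrableDR; apply: integrableZlR; [exact: integrable_cosX|exact: integrable_sinX].
have -> : 1 - (c ^+ 2 + s ^+ 2) = \int[P]_w (1 - g (X w)).
  rewrite RintegralB// Rintegral_cst_probability RintegralD//; first last.
  - by apply: integrableZlR; exact: integrable_sinX.
  - by apply: integrableZlR; exact: integrable_cosX.
  rewrite RintegralZl; [|by []|exact: integrable_cosX].
  rewrite RintegralZl; [|by []|exact: integrable_sinX].
  by rewrite -!expr2.
apply: (@le_trans _ _ (pmf X y0 * (1 - g y0))).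
  by rewrite -mulrA ler_wpM2l// pmf_ge0.
apply: (@Rintegral_ge_atom _ (fun x => 1 - g x)) => //.
- exact: measurable_funB.
- exact: integrableBR.
Qed.

End support.

(** * Decay of the characteristic function from maximality of the span *)

Section maximal_span.
Context d (T : measurableType d) (R : realType) (P : probability T R).
Variables (X : {RV P >-> R}) (a h : R).
Hypothesis Xspan : has_maximal_span P X h.
Hypothesis Xlattice : support_of P X `<=` lattice a h.

Let h0 : 0 < h. Proof. by case: Xspan => -[]. Qed.

Lemma maximal_span_lattice : P (X @^-1` lattice a h) = 1%E.
Proof.
have mlat : measurable (X @^-1` lattice a h).
  by apply: measurable_funPTI; exact: measurable_lattice.
have /negligibleP : P.-negligible (~` (X @^-1` lattice a h)).
  exact: negligible_notin_support.
move=> /(_ (measurableC mlat)); rewrite [LHS]probability_setC// => /eqP.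
by rewrite sube_eq ?fin_num_measure// add0e => /eqP <-.
Qed.

Let defect t := 1 - (cf_re P X t ^+ 2 + cf_im P X t ^+ 2).

Let defect_ge0 t : 0 <= defect t.
Proof.
(* At two equal points the bound by atoms has left side 0. *)
apply: le_trans (cf_norm_le_atoms X 0 0 t).
by rewrite subrr mulr0 cos0 subrr mulr0.
Qed.

(* [G] is a subgroup of the integers containing the differences of atoms, hence
   it is [g Z] for some [g]; if [g] were not 1, the span could be enlarged. *)
Let G (k : int) := exists2 C, 0 <= C & forall t, sin (t * (k%:~R * h) / 2) ^+ 2 <= C * defect t.

Let G0 : G 0.
Proof.
by exists 0 => // t; rewrite mul0r mulr0 mul0r sin0 expr0n mul0r.
Qed.

Let GB x y : G x -> G y -> G (x - y).
Proof.
move=> [C C0 hC] [D D0 hD]; exists (2 * (C + D)) => [|t].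
  by rewrite mulr_ge0// addr_ge0.
have -> : t * ((x - y)%:~R * h) / 2 = t * (x%:~R * h) / 2 + - (t * (y%:~R * h) / 2).
  by rewrite intrB; ring.
rewrite (le_trans (sqr_sin_D_le _ _))// sinN sqrrN.
by have := hC t; have := hD t; lra.
Qed.

(** The half-angle identity [1 - cos y = 2 sin (y / 2) ^ 2] turns [cf_norm_le_atoms] into membership
    in [G]; the constant is the inverse of the product of the two masses. *)
Let Gatom k0 k : 0 < pmf X (a + k0%:~R * h) -> 0 < pmf X (a + k%:~R * h) -> G (k - k0).
Proof.
move=> p0 p1; have p01 := mulr_gt0 p0 p1.
exists (pmf X (a + k0%:~R * h) * pmf X (a + k%:~R * h))^-1 => [|t].
  by rewrite invr_ge0 ltW.
have := cf_norm_le_atoms X (a + k0%:~R * h) (a + k%:~R * h) t.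
rewrite -/(defect t) subr1_cosE => H.
rewrite [leRHS]mulrC ler_pdivlMr// mulrC; apply: le_trans H.
have -> : t * ((k - k0)%:~R * h) / 2 = t * (a + k%:~R * h - (a + k0%:~R * h)) / 2.
  by rewrite intrB; ring.
rewrite ler_wpM2l ?(ltW p01)// ler_peMl ?sqr_ge0//.
by rewrite ler1n.
Qed.

Let G1 : G 1.
Proof.
have [g Gg gdvd] := int_subgroup_principal G0 GB.
have [g1|g1] := eqVneq g 1%N; first by rewrite -[1]/(1%N%:Z) -g1.
(* If [g = 0], all atoms coincide and every span is admissible, so 2 is taken; otherwise [g] itself
   exceeds 1. Either way [m h] is a span larger than [h]. *)
pose m : nat := if g == 0%N then 2%N else g.
have m1 : (1 < m)%N by rewrite /m; case: eqP => //; move: g1; case: (g) => [|[]].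
have [k0 p0] := atom_exists maximal_span_lattice.
have mspan : has_span P X (m%:R * h).
  split; first by rewrite mulr_gt0// ltr0n ltnW.
  exists (a + k0%:~R * h); apply: lattice_support.
    by rewrite mulr_gt0// ltr0n ltnW.
  have mlat : measurable (X @^-1` lattice (a + k0%:~R * h) (m%:R * h)).
    by apply: measurable_funPTI; exact: measurable_lattice.
  suff /negligibleP : P.-negligible (~` (X @^-1` lattice (a + k0%:~R * h) (m%:R * h))).
    move=> /(_ (measurableC mlat)); rewrite [LHS]probability_setC// => /eqP.
    by rewrite sube_eq ?fin_num_measure// add0e => /eqP <-.
  apply: negligibleS (atom_exists_ae maximal_span_lattice) => w nw [k e pk].
  apply: nw; rewrite /= e.
  have /dvdzP[q qE] : (m %| k - k0)%Z.
    have gk := gdvd _ (Gatom p0 pk); rewrite /m; case: eqP => // g00.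
    by move: gk; rewrite g00 dvd0z => /eqP ->.
  exists q => //; have -> : k = q * m%:Z + k0 by rewrite -qE subrK.
  by rewrite intrD intrM -[(m%:Z)%:~R]/(m%:R); ring.
have := Xspan.2 _ mspan; by rewrite ger_pMl// lern1 leqNgt m1.
Qed.

(** [G 1] bounds [sin (t h / 2) ^ 2] by a multiple of the defect, and for [|t| <= pi / h] the angle
    stays within [pi / 2], where the squared sine controls [t ^ 2]. Then [1 - y <= exp (- y)] gives
    the Gaussian form. *)
Lemma maximal_span_cf_decay : exists2 k, 0 < k &
  forall t, `|t| <= pi / h -> cf_re P X t ^+ 2 + cf_im P X t ^+ 2 <= gauss k t.
Proof.
have [C C0 hC] := G1.
(* 36 is the 9 of [sqr_sin_ge] times the 4 of the half angle; [C + 1] replaces [C], which may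
   vanish. *)
exists (h ^+ 2 / (36 * (C + 1))) => [|t tpi].
  by rewrite divr_gt0 ?exprn_gt0 ?mulr_gt0 ?ltr_pwDr.
have H : (t * h / 2) ^+ 2 / 9 <= (C + 1) * defect t.
  apply: (@le_trans _ _ (sin (t * h / 2) ^+ 2)).
    apply: sqr_sin_ge; rewrite normrM normrM (gtr0_norm h0).
    by rewrite (@ger0_norm _ 2^-1)// ler_wpM2r// -ler_pdivlMr.
  have := hC t; rewrite mul1r => /le_trans; apply.
  by rewrite ler_wpM2r// lerDl.
apply: (@le_trans _ _ (1 - h ^+ 2 / (36 * (C + 1)) * t ^+ 2)); last first.
  by rewrite /gauss; have := expR_ge1Dx (- (h ^+ 2 / (36 * (C + 1)) * t ^+ 2)); lra.
suff : h ^+ 2 / (36 * (C + 1)) * t ^+ 2 <= defect t by rewrite /defect; lra.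
have C1 : 0 < C + 1 by rewrite ltr_pwDr.
rewrite -ler_pdivrMl// in H; apply: le_trans H.
rewrite le_eqVlt; apply/orP; left; apply/eqP; field.
by rewrite gt_eqF.
Qed.

End maximal_span.

(** * Convergence of the characteristic functions of the normalised sums *)

Section dominated.
Context d (T : measurableType d) (R : realType) (mu : {measure set T -> \bar R}).

Lemma Rdominated_cvg0 (f_ : nat -> T -> R) (g : T -> R) :
  (forall n, measurable_fun setT (f_ n)) -> mu.-integrable setT (EFin \o g) ->
  (forall n w, `|f_ n w| <= g w) -> (forall w, f_ n w @[n --> \oo] --> 0) ->
  \int[mu]_w f_ n w @[n --> \oo] --> 0.
Proof.
move=> mf ig fg f0; apply: fine_cvg; rewrite -[0%:E](integral0 mu setT).
apply: (@dominated_cvg _ _ _ mu setT measurableT _ _ (EFin \o g)) => //.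
- by move=> n; apply/measurable_EFinP.
- by move=> w _; apply: cvg_EFin; [exact: nearW|exact: f0].
- by move=> n w _; rewrite lee_fin.
Qed.

End dominated.

Section characteristic_function_limit.
Context d (T : measurableType d) (R : realType) (P : probability T R).

Lemma sqr_divsqrt (u : R) n : (0 < n)%N -> (u / Num.sqrt n%:R) ^+ 2 = u ^+ 2 / n%:R.
Proof. by move=> n0; rewrite expr_div_n sqr_sqrtr. Qed.

Lemma cvg_natV_sqrt : ((Num.sqrt n%:R)^-1 : R) @[n --> \oo] --> 0.
Proof.
have -> : (fun n => (Num.sqrt n%:R)^-1 : R) = (fun n => Num.sqrt (n%:R^-1 : R)).
  by apply/funext => n; rewrite sqrtrV.
by rewrite -[X in _ --> X]sqrtr0; apply: continuous_cvg; [exact: sqrt_continuous|exact: cvg_natV].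
Qed.

Section taylor.
Variables (X : {RV P >-> R}) (u : R).
Hypothesis X2 : P.-integrable setT (EFin \o (fun w => X w ^+ 2)).
Let v := \int[P]_w X w ^+ 2.
Let t n : R := u / Num.sqrt n%:R.

Let i1 := integrable_cst_probability P (1 : R).

Let nt2 n w : (0 < n)%N -> n%:R * (t n * X w) ^+ 2 = u ^+ 2 * X w ^+ 2.
Proof.
move=> n0; rewrite exprMn sqr_divsqrt//; field.
by rewrite pnatr_eq0 -lt0n.
Qed.

Lemma cvg_cstM_natV (c : R) : (c * n%:R^-1) @[n --> \oo] --> 0.
Proof. by rewrite -(mulr0 c); apply: cvgMr; exact: cvg_natV. Qed.

(** The integrand tends to 0 pointwise at rate [1 / n] and is dominated by [u ^ 2 X ^ 2], integrable
    by the second moment hypothesis. *)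
Lemma cvg_cf_re_taylor :
  n%:R * (cf_re P X (t n) - 1 + t n ^+ 2 * v / 2) @[n --> \oo] --> 0.
Proof.
pose f n w := n%:R * (cos (t n * X w) - 1 + (t n * X w) ^+ 2 / 2).
have E n : n%:R * (cf_re P X (t n) - 1 + t n ^+ 2 * v / 2) = \int[P]_w f n w.
  have h1 := integrable_cosX X (t n).
  have h2 : P.-integrable setT (EFin \o (fun w => (t n * X w) ^+ 2 / 2)).
    rewrite (_ : (fun w => _) = (fun w => (t n ^+ 2 / 2) * X w ^+ 2)); last first.
      by apply/funext => w; ring.
    exact: integrableZlR.
  rewrite RintegralZl//; last by apply: integrableDR => //; exact: integrableBR.
  rewrite RintegralD//; last exact: integrableBR.
  rewrite RintegralB// Rintegral_cst_probability; congr (_ * (_ + _)).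
  rewrite -mulrAC -RintegralZl//; apply: eq_Rintegral => w _; ring.
under eq_fun do rewrite E.
apply: (@Rdominated_cvg0 _ _ _ _ _ (fun w => u ^+ 2 * X w ^+ 2)).
- move=> n; apply: measurable_funM => //; apply: measurable_funD.
    by apply: measurable_funB => //; exact: measurable_cosX.
  by apply: measurable_funM => //; apply: measurable_funX; exact: measurable_funM.
- exact: integrableZlR.
(* [nt2] asks for [n > 0]; at 0 the factor [n] annihilates the function. *)
- move=> [|n] w; first by rewrite /f mul0r normr0 mulr_ge0// sqr_ge0.
  rewrite /f normrM ger0_norm//.
  apply: (le_trans (ler_wpM2l _ (normr_cos_taylor2_le_sqr _))) => //.
  by rewrite nt2.
- move=> w; apply: (@squeeze_cvgr _ _ _ _ (fun n => - ((u * X w) ^+ 4 / 24 * n%:R^-1))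
    (fun n => (u * X w) ^+ 4 / 24 * n%:R^-1)).
  + near=> n; have n0 : (0 < n)%N by near: n; exact: nbhs_infty_gt.
    rewrite -ler_norml /f normrM ger0_norm//.
    apply: (le_trans (ler_wpM2l _ (normr_cos_taylor2_le _))) => //.
    have -> : (t n * X w) ^+ 4 = (u * X w) ^+ 4 / n%:R ^+ 2.
      have -> : (t n * X w) ^+ 4 = (t n ^+ 2) ^+ 2 * X w ^+ 4 by ring.
      rewrite sqr_divsqrt//.
      by field; rewrite pnatr_eq0 -lt0n.
    rewrite le_eqVlt; apply/orP; left; apply/eqP; field.
    by rewrite pnatr_eq0 -lt0n.
  + by rewrite -oppr0; apply: cvgN; exact: cvg_cstM_natV.
  + exact: cvg_cstM_natV.
Unshelve. all: by end_near. Qed.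

(** Centring allows the linear term to be subtracted at no cost; the cubic bound on [sin y - y] then
    gives the pointwise rate [1 / sqrt n]. *)
Lemma cvg_cf_im_taylor : \int[P]_w X w = 0 -> n%:R * cf_im P X (t n) @[n --> \oo] --> 0.
Proof.
move=> X0; have X1 := integrable_sqr_integrable X2.
pose f n w := n%:R * (sin (t n * X w) - t n * X w).
have E n : n%:R * cf_im P X (t n) = \int[P]_w f n w.
  have h1 := integrable_sinX X (t n).
  have h2 : P.-integrable setT (EFin \o (fun w => t n * X w)) by exact: integrableZlR.
  rewrite RintegralZl//; last exact: integrableBR.
  by rewrite RintegralB// RintegralZl// X0 mulr0 subr0.
under eq_fun do rewrite E.
apply: (@Rdominated_cvg0 _ _ _ _ _ (fun w => u ^+ 2 * X w ^+ 2)).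
- move=> n; apply: measurable_funM => //; apply: measurable_funB.
    exact: measurable_sinX.
  exact: measurable_funM.
- exact: integrableZlR.
- move=> [|n] w; first by rewrite /f mul0r normr0 mulr_ge0// sqr_ge0.
  rewrite /f normrM ger0_norm//.
  apply: (le_trans (ler_wpM2l _ (normr_sin_taylor1_le_sqr _))) => //.
  by rewrite nt2.
- move=> w; pose c := `|u * X w| ^+ 3 / 6.
  have cvgc : c * (Num.sqrt n%:R)^-1 @[n --> \oo] --> 0.
    by rewrite -(mulr0 c); apply: cvgMr; exact: cvg_natV_sqrt.
  apply: (@squeeze_cvgr _ _ _ _ (fun n => - (c * (Num.sqrt n%:R)^-1))
    (fun n => c * (Num.sqrt n%:R)^-1)) => //.
  + near=> n; have n0 : (0 < n)%N by near: n; exact: nbhs_infty_gt.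
    rewrite -ler_norml /f normrM ger0_norm//.
    apply: (le_trans (ler_wpM2l _ (normr_sin_taylor1_le _))) => //.
    have s0 : 0 < Num.sqrt n%:R :> R by rewrite sqrtr_gt0 ltr0n.
    have nE : n%:R = Num.sqrt n%:R ^+ 2 :> R by rewrite sqr_sqrtr.
    have -> : `|t n * X w| = `|u * X w| / Num.sqrt n%:R.
      by rewrite /t mulrAC normrM (gtr0_norm (_ : 0 < _^-1)) ?invr_gt0.
    rewrite [X in X * _]nE /c le_eqVlt; apply/orP; left; apply/eqP; field.
    by rewrite gt_eqF.
  + by rewrite -oppr0; apply: cvgN.
Unshelve. all: by end_near. Qed.

End taylor.

Section sums.
Variable Y : nat -> {RV P >-> R}.
Hypothesis Yindep : mutually_independent P Y.
Hypothesis Yident : identically_distributed P Y.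
Hypothesis Y2 : P.-integrable setT (EFin \o (fun w => Y 0%N w ^+ 2)).
Hypothesis Y1 : \int[P]_w Y 0%N w = 0.
Let v := \int[P]_w Y 0%N w ^+ 2.

(** For [n > 0] the limit is itself an [n]-th power, [gauss (v / 2) u = exp (- v u ^ 2 / (2 n)) ^
    n], so [cf_sum_dist] reduces the claim to [n] times the one-step errors, handled by the two
    Taylor lemmas. *)
Lemma cvg_cf_sum u :
  `|cf_re P (partial_sum Y n) (u / Num.sqrt n%:R) - gauss (v / 2) u| +
  `|cf_im P (partial_sum Y n) (u / Num.sqrt n%:R)| @[n --> \oo] --> 0.
Proof.
pose t n : R := u / Num.sqrt n%:R.
pose A n := n%:R * (cf_re P (Y 0%N) (t n) - 1 + t n ^+ 2 * v / 2).
pose B n := n%:R * cf_im P (Y 0%N) (t n).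
(* [n] times the error [y ^ 2 / 2] of [exp (- y)] against [1 - y], at [y = v u ^ 2 / (2 n)], is
   [K / n]. *)
pose K : R := (v * u ^+ 2 / 2) ^+ 2 / 2.
have cA : A n @[n --> \oo] --> 0 by exact: cvg_cf_re_taylor.
have cB : B n @[n --> \oo] --> 0 by exact: cvg_cf_im_taylor.
have v0 : 0 <= v by apply: Rintegral_ge0 => w _; exact: sqr_ge0.
apply: (@squeeze_cvgr _ _ _ _ (cst 0) (fun n => 2 * (`|A n| + K * n%:R^-1 + `|B n|))).
- near=> n; have n0 : (0 < n)%N by near: n; exact: nbhs_infty_gt.
  rewrite addr_ge0//=.
  pose y := v / 2 * u ^+ 2 / n%:R; pose b := expR (- y).
  have y0 : 0 <= y by rewrite /y divr_ge0// mulr_ge0 ?sqr_ge0// divr_ge0.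
  have bn : gauss (v / 2) u = b ^+ n.
    rewrite /b -expRM_natl /gauss mulrN; congr (expR (- _)); rewrite /y; field.
    by rewrite pnatr_eq0 -lt0n.
  have b01 : 0 <= b <= 1 by rewrite expR_ge0/= -[leRHS]expR0 ler_expR oppr_le0.
  rewrite bn; apply: (le_trans (cf_sum_dist Yindep Yident _ _ b01)).
  rewrite -/(t n) -mulrA ler_wpM2l// mulrDr lerD//; last first.
    by rewrite /B normrM (ger0_norm (ler0n _ n)).
  have cb : `|cf_re P (Y 0) (t n) - b| <= `|cf_re P (Y 0) (t n) - 1 + t n ^+ 2 * v / 2| + y ^+ 2 / 2.
    have -> : cf_re P (Y 0) (t n) - b = (cf_re P (Y 0) (t n) - 1 + t n ^+ 2 * v / 2) - (b - 1 + y).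
      rewrite (_ : t n ^+ 2 * v / 2 = y); first by ring.
      by rewrite sqr_divsqrt// /y; field; rewrite pnatr_eq0 -lt0n.
    rewrite (le_trans (ler_normB _ _))// lerD//.
    have := expRN_le_taylor2 y0; have := expR_ge1Dx (- y); rewrite -/b => h1 h2.
    by rewrite ger0_norm; lra.
  apply: (le_trans (ler_wpM2l (ler0n _ n) cb)); rewrite mulrDr /A normrM (ger0_norm (ler0n _ n)).
  rewrite lerD// le_eqVlt; apply/orP; left; apply/eqP; rewrite /K /y; field.
  by rewrite pnatr_eq0 -lt0n.
- exact: cvg_cst.
- have : 2 * (`|A n| + K * n%:R^-1 + `|B n|) @[n --> \oo] --> 2 * (`|0 : R| + 0 + `|0 : R|).
    by apply: cvgMr; apply: cvgD; [apply: cvgD; [exact: cvg_norm|exact: cvg_cstM_natV]|exact: cvg_norm].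
  by rewrite normr0 !addr0 mulr0.
Unshelve. all: by end_near. Qed.

Lemma normalised_sumE n w : normalised_sum Y n w = (Num.sqrt n%:R)^-1 * partial_sum Y n w.
Proof. by []. Qed.

Lemma cf_re_normalised_sum n u :
  cf_re P (normalised_sum Y n) u = cf_re P (partial_sum Y n) (u / Num.sqrt n%:R).
Proof. by apply: eq_Rintegral => w _; rewrite /= normalised_sumE mulrA. Qed.

Lemma cf_im_normalised_sum n u :
  cf_im P (normalised_sum Y n) u = cf_im P (partial_sum Y n) (u / Num.sqrt n%:R).
Proof. by apply: eq_Rintegral => w _; rewrite /= normalised_sumE mulrA. Qed.

Lemma integrable_normalised_sum_sqr n :
  P.-integrable setT (EFin \o (fun w => normalised_sum Y n w ^+ 2)).
Proof.
have [h _ _] := partial_sum_moments Yindep Yident Y2 Y1 n.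
rewrite (_ : (fun w => _) = (fun w => (Num.sqrt n%:R)^-1 ^+ 2 * partial_sum Y n w ^+ 2)); last first.
  by apply/funext => w; rewrite normalised_sumE exprMn.
exact: integrableZlR.
Qed.

Lemma normalised_sum_mean n : \int[P]_w normalised_sum Y n w = 0.
Proof.
have [h e _] := partial_sum_moments Yindep Yident Y2 Y1 n.
under eq_Rintegral do rewrite normalised_sumE.
by rewrite RintegralZl// ?e ?mulr0//; exact: integrable_sqr_integrable.
Qed.

Lemma normalised_sum_variance n : (0 < n)%N -> \int[P]_w normalised_sum Y n w ^+ 2 = v.
Proof.
move=> n0; have [h _ e] := partial_sum_moments Yindep Yident Y2 Y1 n.
under eq_Rintegral do rewrite normalised_sumE exprMn.
rewrite RintegralZl// e exprVn sqr_sqrtr// mulrA mulVf ?mul1r//.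
by rewrite pnatr_eq0 -lt0n.
Qed.

End sums.
End characteristic_function_limit.

(** * Local limit theorem on the lattice *)

Section local_limit.
Context d (T : measurableType d) (R : realType) (P : probability T R).
Notation mu := (@lebesgue_measure R).

Lemma continuous_cf_re (X : {RV P >-> R}) : continuous (cf_re P X).
Proof.
move=> u; have uI : u \in (`]u - 1, u + 1[%classic : set R).
  by rewrite inE/= in_itv/= ltrBlDr ltrDl ltr01.
apply: (@continuity_under_integral _ _ _ P (fun t w => cos (t * X w)) setT measurableT
  (u - 1) (u + 1) _ _ (fun=> 1)) => //.
- by move=> x _; exact: integrable_cosX.
- by apply: aeW => w _ x _; exact: continuous_cosM.
- by apply: integrable_le1 => // w; rewrite normr1.
- by move=> x _; apply: aeW => w _; exact: cos_max.
Qed.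

Lemma continuous_cf_im (X : {RV P >-> R}) : continuous (cf_im P X).
Proof.
move=> u; have uI : u \in (`]u - 1, u + 1[%classic : set R).
  by rewrite inE/= in_itv/= ltrBlDr ltrDl ltr01.
apply: (@continuity_under_integral _ _ _ P (fun t w => sin (t * X w)) setT measurableT
  (u - 1) (u + 1) _ _ (fun=> 1)) => //.
- by move=> x _; exact: integrable_sinX.
- by apply: aeW => w _ x _; exact: continuous_sinM.
- by apply: integrable_le1 => // w; rewrite normr1.
- by move=> x _; apply: aeW => w _; exact: sin_max.
Qed.

Lemma measurable_cf_re (X : {RV P >-> R}) : measurable_fun setT (cf_re P X).
Proof. by apply: continuous_measurable_fun; exact: continuous_cf_re. Qed.

Lemma measurable_cf_im (X : {RV P >-> R}) : measurable_fun setT (cf_im P X).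
Proof. by apply: continuous_measurable_fun; exact: continuous_cf_im. Qed.

Variable Y : nat -> {RV P >-> R}.
Hypothesis Yindep : mutually_independent P Y.
Hypothesis Yident : identically_distributed P Y.
Hypothesis Y2 : P.-integrable setT (EFin \o (fun w => Y 0%N w ^+ 2)).
Hypothesis Y1 : \int[P]_w Y 0%N w = 0.
Variables (a h : R).
Hypothesis Yspan : has_maximal_span P (Y 0%N) h.
Hypothesis Ylattice : support_of P (Y 0%N) `<=` lattice a h.
Let v := \int[P]_w Y 0%N w ^+ 2.
Let h0 : 0 < h. Proof. by case: Yspan => -[]. Qed.

(** If the variance vanished, [1 - y ^ 2 / 2 <= cos y] would make the real part of the
    characteristic function at least 1 at [pi / h], against its strict decay there. *)
Lemma variance_gt0 : 0 < v.
Proof.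
rewrite lt_neqAle; apply/andP; split; last by apply: Rintegral_ge0 => w _; exact: sqr_ge0.
apply/eqP => v0; have [k k0 hk] := maximal_span_cf_decay Yspan Ylattice.
have pih : 0 < pi / h by rewrite divr_gt0// pi_gt0.
have := hk (pi / h); rewrite gtr0_norm// => /(_ (lexx _)).
apply/negP; rewrite -ltNge; apply: (@lt_le_trans _ _ 1).
  by rewrite /gauss -[ltRHS]expR0 ltr_expR oppr_lt0 mulr_gt0// exprn_gt0.
suff c1 : 1 <= cf_re P (Y 0%N) (pi / h).
  by rewrite (le_trans (exprn_ege1 2 c1))// lerDl sqr_ge0.
set t := pi / h.
have i1 := integrable_cst_probability P (1 : R).
have i2 : P.-integrable setT (EFin \o (fun w => t ^+ 2 / 2 * Y 0%N w ^+ 2)).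
  exact: integrableZlR.
have -> : 1 = \int[P]_w (1 - t ^+ 2 / 2 * Y 0%N w ^+ 2).
  by rewrite RintegralB// Rintegral_cst_probability RintegralZl// -/v -v0 mulr0 subr0.
apply: le_Rintegral => //; [exact: integrableBR|exact: integrable_cosX|move=> w _].
by have := cos_ge_taylor2 (t * Y 0%N w); rewrite exprMn; lra.
Qed.

Lemma normalised_sum_lattice n : (0 < n)%N ->
  P (normalised_sum Y n @^-1` lattice (Num.sqrt n%:R * a) (h / Num.sqrt n%:R)) = 1%E.
Proof.
move=> n0.
have mlat b e : measurable (lattice b e : set R) by exact: measurable_lattice.
have ml i : P (Y i @^-1` lattice a h) = 1%E.
  rewrite -[LHS]/(distribution P (Y i) _) (Yident i 0)//.
  exact: (maximal_span_lattice Ylattice).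
have nl : P.-negligible (\bigcup_i ~` (Y i @^-1` lattice a h)).
  apply: negligible_bigcup => i; apply/negligibleP.
    by apply: measurableC; exact: measurable_funPTI.
  by rewrite [LHS]probability_setC ?ml ?subee//; exact: measurable_funPTI.
have mS : measurable (normalised_sum Y n @^-1` lattice (Num.sqrt n%:R * a) (h / Num.sqrt n%:R)).
  exact: measurable_funPTI.
suff /negligibleP : P.-negligible (~` (normalised_sum Y n @^-1` lattice (Num.sqrt n%:R * a) (h / Num.sqrt n%:R))).
  move=> /(_ (measurableC mS)); rewrite [LHS]probability_setC// => /eqP.
  by rewrite sube_eq ?fin_num_measure// add0e => /eqP <-.
apply: negligibleS nl => w nS; apply: contrapT => nU; apply: nS.
have Yw i : lattice a h (Y i w).
  by apply: contrapT => nYi; apply: nU; exists i.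
(* Before scaling the offset of the sum is [n a]; dividing by [sqrt n] gives [sqrt n * a]. *)
have [k _ e] : lattice (n%:R * a) h (partial_sum Y n w).
  elim: n {n0 mS} => [|n [k _ e]]; first by exists 0 => //; rewrite /partial_sum big_ord0 !mul0r addr0.
  have [j _ ej] := Yw n; exists (k + j) => //.
  by rewrite partial_sumS -e -ej intrD -natr1; ring.
exists k => //; rewrite normalised_sumE -e.
have s0 : 0 < Num.sqrt n%:R :> R by rewrite sqrtr_gt0 ltr0n.
have -> : n%:R * a = Num.sqrt n%:R ^+ 2 * a by rewrite sqr_sqrtr.
field.
by rewrite gt_eqF.
Qed.

Lemma local_limit_lattice : exists2 I : nat -> R, I n @[n --> \oo] --> 0 &
  forall n x, (0 < n)%N -> lattice (Num.sqrt n%:R * a) (h / Num.sqrt n%:R) x ->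
    `|pmf (normalised_sum Y n : {RV P >-> R}) x - h / Num.sqrt n%:R * normal_pdf 0 (Num.sqrt v) x| <=
    h / Num.sqrt n%:R * I n.
Proof.
have v0 := variance_gt0; have pi0 := pi_gt0 R.
have sv : Num.sqrt v ^+ 2 = v by rewrite sqr_sqrtr// ltW.
have [k k0 hk] := maximal_span_cf_decay Yspan Ylattice.
pose C n u := cf_re P (normalised_sum Y n) u.
pose S n u := cf_im P (normalised_sum Y n) u.
pose D n : set R := `[- (pi / (h / Num.sqrt n%:R)), pi / (h / Num.sqrt n%:R)]%classic.
(* Outside [D n] the indicators leave only the Gaussian tail, so one integral over the line covers
   both parts of the error. *)
pose f n u := `|\1_(D n) u * C n u - gauss (v / 2) u| + \1_(D n) u * `|S n u|.
have mD n : measurable (D n) by exact: measurable_itv.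
have m1D n : measurable_fun setT (\1_(D n) : R -> R) by exact: measurable_indic.
have mC n : measurable_fun setT (C n) by exact: measurable_cf_re.
have mS n : measurable_fun setT (S n) by exact: measurable_cf_im.
have mf n : measurable_fun setT (f n).
  apply: measurable_funD.
    apply: measurableT_comp => //; apply: measurable_funB; last exact: measurable_gauss.
    exact: measurable_funM.
  by apply: measurable_funM => //; exact: measurableT_comp.
(* One copy of [gauss (k / 2)] for each of the real and imaginary parts; the last summand covers the
   Gaussian. *)
pose g u := 2 * gauss (k / 2) u + gauss (v / 2) u.
have ig : mu.-integrable setT (EFin \o g).
  rewrite /g /comp; under eq_fun do rewrite EFinD EFinM.
  apply: integrableD => //; last by apply: integrable_gauss; rewrite divr_gt0.
  by apply: integrableZl => //; apply: integrable_gauss; rewrite divr_gt0.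
have decay n u : (0 < n)%N -> D n u -> `|C n u| <= gauss (k / 2) u /\ `|S n u| <= gauss (k / 2) u.
  move=> n0 Du.
  have s0 : 0 < Num.sqrt n%:R :> R by rewrite sqrtr_gt0 ltr0n.
  have ut : `|u / Num.sqrt n%:R| <= pi / h.
    move: Du; rewrite /D/= in_itv/= -ler_norml normrM (gtr0_norm (_ : 0 < _^-1)) ?invr_gt0//.
    rewrite ler_pdivrMr//; suff -> : pi / (h / Num.sqrt n%:R) = pi / h * Num.sqrt n%:R by [].
    by field; rewrite !gt_eqF.
  have CS : C n u ^+ 2 + S n u ^+ 2 <= gauss (k / 2) u ^+ 2.
    rewrite /C /S cf_re_normalised_sum// cf_im_normalised_sum// cf_sum_norm//.
    (* The rate survives normalisation: the [n]-th power of [gauss k] at [u / sqrt n] is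
       [gauss k u]. *)
    have -> : gauss (k / 2) u ^+ 2 = gauss k (u / Num.sqrt n%:R) ^+ n.
      rewrite /gauss -!expRM_natl sqr_divsqrt//; congr expR; field.
      by rewrite pnatr_eq0 -lt0n.
    by rewrite lerXn2r ?nnegrE ?gauss_ge0 ?addr_ge0 ?sqr_ge0// hk.
  split; rewrite -(ger0_norm (gauss_ge0 (k / 2) u)) -ler_sqr ?nnegrE//.
    by rewrite !real_normK ?num_real//; apply: le_trans CS; rewrite lerDl sqr_ge0.
  by rewrite !real_normK ?num_real//; apply: le_trans CS; rewrite lerDr sqr_ge0.
have m0 n u : ~ D n u -> \1_(D n) u = 0 :> R by move=> nD; rewrite indicE memNset.
have m1 n u : D n u -> \1_(D n) u = 1 :> R by move=> nD; rewrite indicE mem_set.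
have fg n u : (0 < n)%N -> `|f n u| <= g u.
  move=> n0; rewrite ger0_norm; last by rewrite addr_ge0// mulr_ge0.
  have G1 := gauss_ge0 (k / 2) u; have G2 := gauss_ge0 (v / 2) u.
  rewrite /f /g; have [Du|nDu] := pselect (D n u).
    have [hC hS] := decay _ _ n0 Du; rewrite m1// !mul1r.
    have := ler_normB (C n u) (gauss (v / 2) u); rewrite (ger0_norm G2); lra.
  by rewrite m0// !mul0r addr0 sub0r normrN ger0_norm//; lra.
have int_f n : (0 < n)%N -> mu.-integrable setT (EFin \o f n).
  move=> n0; apply: integrable_le_norm (mf n) ig _ => u.
  by rewrite (le_trans (fg _ _ n0))// ler_norm.
have cvgf u : f n u @[n --> \oo] --> 0.
  apply: cvg_trans (cvg_cf_sum Yindep Yident Y2 Y1 u); apply: near_eq_cvg; near=> n.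
  have n0 : (0 < n)%N by near: n; exact: nbhs_infty_gt.
  have s0 : 0 < Num.sqrt n%:R :> R by rewrite sqrtr_gt0 ltr0n.
  rewrite /f m1 ?mul1r /C /S ?cf_re_normalised_sum ?cf_im_normalised_sum//.
  rewrite /D/= in_itv/= -ler_norml.
  have -> : pi / (h / Num.sqrt n%:R) = pi / h * Num.sqrt n%:R by field; rewrite !gt_eqF.
  rewrite -ler_pdivrMl ?divr_gt0//.
  (* Squaring turns membership in [D n] into a lower bound on [n], which holds eventually. *)
  rewrite -(@ler_pXn2r _ 2)// ?nnegrE ?mulr_ge0 ?invr_ge0 ?divr_ge0 ?(ltW h0) ?(ltW pi0)//.
  by rewrite sqr_sqrtr//; near: n; exact: nbhs_infty_ger.
exists (fun n => (2 * pi)^-1 * \int[mu]_u f n u).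
  (* The domination by [g] holds for [n > 0], so dominated convergence is applied to the shifted
     sequence. *)
  have cI : \int[mu]_u f n.+1 u @[n --> \oo] --> 0.
    apply: (@Rdominated_cvg0 _ _ _ mu (fun n => f n.+1) g) => // [n|n u|u]; [exact: mf|exact: fg|].
    by rewrite (cvg_shiftS (fun n => f n u)).
  rewrite -(mulr0 (2 * pi)^-1); apply: cvgMr.
  by rewrite -(cvg_shiftS (fun n => \int[mu]_u f n u)).
move=> n x n0 xl.
have s0 : 0 < Num.sqrt n%:R :> R by rewrite sqrtr_gt0 ltr0n.
set dl := h / Num.sqrt n%:R; have dl0 : 0 < dl by rewrite divr_gt0.
(* The integrand of the inversion formula, extended by 0 so that the Gaussian one can be subtracted
   from it over the whole line. *)
pose F u := \1_(D n) u * (C n u * cos (u * x) + S n u * sin (u * x)).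
have intF : mu.-integrable setT (EFin \o F).
  apply: (@integrable_le_norm _ F (fun u => 2 * gauss (k / 2) u)).
  - apply: measurable_funM => //; apply: measurable_funD; apply: measurable_funM => //.
      exact: measurable_cosM.
    exact: measurable_sinM.
  - rewrite /comp; under eq_fun do rewrite EFinM.
    by apply: integrableZl => //; apply: integrable_gauss; rewrite divr_gt0.
  - move=> u; rewrite [leRHS]ger0_norm ?mulr_ge0 ?gauss_ge0// /F.
    have [Du|nDu] := pselect (D n u); last by rewrite m0// mul0r normr0 mulr_ge0 ?gauss_ge0.
    have [hC hS] := decay _ _ n0 Du; rewrite m1// mul1r.
    rewrite (le_trans (ler_normD _ _))// mulr2n mulrDl !mul1r lerD// normrM.
      by apply: le_trans hC; rewrite ler_piMr// cos_max.
    by apply: le_trans hS; rewrite ler_piMr// sin_max.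
have v20 : 0 < v / 2 by rewrite divr_gt0.
have pE : pmf (normalised_sum Y n : {RV P >-> R}) x = dl * ((2 * pi)^-1 * \int[mu]_u F u).
  have := fourier_inversion_lattice dl0 (normalised_sum_lattice n0) xl.
  rewrite Rintegral_mkcond (_ : (fun _ => _) \_ _ = F); last first.
    apply/funext => u; rewrite patchE /F indicE; case: ifP => _; by rewrite ?mul1r ?mul0r.
  move=> <-; have alg (A B p : R) : 0 < A -> 0 < B -> p = B * (A^-1 * (A / B * p)).
    by move=> A0 B0; field; rewrite !gt_eqF.
  by apply: alg => //; rewrite mulr_gt0.
rewrite pE normal_pdf_fourier ?sqrtr_gt0// sv -mulrBr -mulrBr.
rewrite normrM (gtr0_norm dl0) ler_pM2l// normrM gtr0_norm ?invr_gt0 ?mulr_gt0//.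
rewrite ler_pM2l ?invr_gt0 ?mulr_gt0//.
have intG := integrable_cos_gauss x v20.
have intFG : mu.-integrable setT (EFin \o (fun u => F u - cos (u * x) * gauss (v / 2) u)).
  by rewrite /comp; under eq_fun do rewrite EFinB; exact: integrableB.
rewrite -RintegralB//; apply: (le_trans (le_normr_Rintegral _ _)) => //.
apply: le_Rintegral => //; [|exact: int_f|].
  by apply: eq_integrable (integrable_abse intFG).
move=> u _; rewrite /F /f mulrDr.
have -> : \1_(D n) u * (C n u * cos (u * x)) + \1_(D n) u * (S n u * sin (u * x)) -
    cos (u * x) * gauss (v / 2) u = (\1_(D n) u * C n u - gauss (v / 2) u) * cos (u * x) +
    \1_(D n) u * (S n u * sin (u * x)) by ring.
rewrite (le_trans (ler_normD _ _))// lerD//.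
  by rewrite normrM ler_piMr// cos_max.
rewrite normrM ger0_norm// normrM ler_wpM2l// ler_piMr// sin_max//.
Unshelve. all: by end_near. Qed.

End local_limit.

(** * Sums over the lattice as integrals *)

Section esum_integral.
Context d (T : measurableType d) (R : realType) (mu : {measure set T -> \bar R}).
Local Open Scope ereal_scope.

(** Finite partial sums are integrals over finite disjoint unions. Applied to the fibres of a random
    variable, for sums against [pmf], and to the lattice cells, for the total mass of the quantised
    Gaussian. *)
Lemma esum_integral_le (I : choiceType) (A : set I) (J : I -> set T) (f : T -> \bar R) :
  (forall i, measurable (J i)) -> trivIset A J -> measurable_fun setT f ->
  (forall x, 0 <= f x) -> \esum_(i in A) \int[mu]_(x in J i) f x <= \int[mu]_x f x.
Proof.
move=> mJ tJ mf f0; apply: ge_ereal_sup => _ [F [finF FA] <-].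
rewrite fsbig_finite// -ge0_integral_bigsetU//.
- apply: ge0_subset_integral => //.
  by apply: bigsetU_measurable => i _.
- apply: sub_trivIset tJ => i /=; rewrite in_fset_set// inE; exact: FA.
- exact: measurable_funTS.
Qed.

End esum_integral.

Section discrete_law.
Context d (T : measurableType d) (R : realType) (P : probability T R).
Local Open Scope ereal_scope.

Lemma esum_pmf_le (X : {RV P >-> R}) (A : set R) (g : R -> R) : measurable_fun setT g ->
  (forall x, 0 <= g x)%R ->
  \esum_(x in A) (pmf X x * g x)%:E <= \int[P]_w (g (X w))%:E.
Proof.
move=> mg g0.
have mX x : measurable (X @^-1` [set x]) by exact: measurable_funPTI.
rewrite (eq_esum (b := fun x => \int[P]_(w in X @^-1` [set x]) (g (X w))%:E)).
  apply: esum_integral_le => //.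
  - by move=> x y _ _ [w [/= -> ->]].
  - by apply/measurable_EFinP; exact: measurableT_comp.
  - by move=> w; rewrite lee_fin.
move=> x _; rewrite (eq_integral (fun=> (g x)%:E)); last first.
  by move=> w; rewrite inE/= => ->.
rewrite integral_cst// EFinM muleC; congr (_ * _).
by rewrite /pmf fineK// fin_num_measure.
Qed.

Lemma esum_pmf_lattice (X : {RV P >-> R}) (a h : R) : P (X @^-1` lattice a h) = 1 ->
  1 <= \esum_(x in lattice a h) (pmf X x)%:E.
Proof.
move=> PX; pose e (k : int) : R := (a + k%:~R * h)%R.
(* Finite windows exhaust the lattice, so continuity of [P] from below gives the bound. *)
pose Z (n : nat) : set R := e @` [set k : int | (`|k| <= n)%N].
have finZ n : finite_set (Z n).
  apply: finite_image.
  apply: (@sub_finite_set _ _ ((fun m : nat => m%:Z) @` `I_n.+1 `|` (fun m : nat => (- m%:Z)%R) @` `I_n.+1)).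
    move=> k /= kn; have [k0|k0] := leP 0%R k.
      by left; exists `|k|%N => //=; rewrite gez0_abs.
    by right; exists `|k|%N => //=; rewrite ltz0_abs// opprK.
  by rewrite finite_setU; split; apply: finite_image; exact: finite_II.
have mX x : measurable (X @^-1` [set x]) by exact: measurable_funPTI.
have FE n : X @^-1` Z n = \bigcup_(x in Z n) X @^-1` [set x].
  apply/seteqP; split=> [w /= Zw|w [x Zx /= ->]//]; by exists (X w).
have mF n : measurable (X @^-1` Z n).
  by rewrite FE; apply: fin_bigcup_measurable.
have PF n : P (X @^-1` Z n) <= \esum_(x in lattice a h) (pmf X x)%:E.
  apply: esum_ge; exists (Z n).
    by split => // _ [k _ <-]; exists k.
  rewrite FE measure_fin_bigcup//; last by move=> x y _ _ [w [/= -> ->]].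
  rewrite le_eqVlt; apply/orP; left; apply/eqP; apply: eq_fsbigr => x _.
  by rewrite /pmf fineK// fin_num_measure.
have UE : \bigcup_n (X @^-1` Z n) = X @^-1` lattice a h.
  apply/seteqP; split=> [w [n _ [k _ e1]]|w [k _ e1]]; first by exists k.
  by exists `|k|%N => //; exists k => //=.
rewrite -PX -UE.
have cv : (P \o (fun n => X @^-1` Z n)) n @[n --> \oo] --> P (\bigcup_n (X @^-1` Z n)).
  apply: nondecreasing_cvg_mu => //; first exact: bigcup_measurable.
  move=> n m nm; apply/subsetPset => w /= [k /= kn e1]; exists k => //=.
  exact: leq_trans nm.
rewrite -(cvg_lim _ cv)//; apply: lime_le; first by apply/cvg_ex; eexists; exact: cv.
by apply: nearW => n; exact: PF.
Qed.

End discrete_law.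

(** * Estimates for the quantised Gaussian *)

Section quantised_gaussian_bounds.
Variable R : realType.
Notation mu := (@lebesgue_measure R).
Variables (s dl : R).
Hypotheses (s0 : 0 < s) (dl0 : 0 < dl).
Notation phi := (normal_pdf 0 s).
Notation q := (quantised_gaussian 0 s dl).
Let sn0 : s != 0. Proof. by rewrite gt_eqF. Qed.

Lemma normal_pdf0E (x : R) : phi x = normal_peak s * gauss (2 * s ^+ 2)^-1 x.
Proof.
rewrite normal_pdfE// /normal_fun subr0 /gauss -mulr_natr; congr (_ * expR _).
by field.
Qed.

Lemma normal_pdf0_gt0 (x : R) : 0 < phi x.
Proof. by rewrite normal_pdf0E mulr_gt0 ?normal_peak_gt0// expR_gt0. Qed.

Lemma normal_pdf0_le (x y : R) : `|x| <= `|y| -> phi y <= phi x.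
Proof.
move=> xy; rewrite !normal_pdf0E ler_pM2l ?normal_peak_gt0// ler_expR lerN2.
rewrite ler_pM2l ?invr_gt0 ?mulr_gt0 ?exprn_gt0//.
by rewrite -[leLHS]real_normK ?num_real// -[leRHS]real_normK ?num_real// lerXn2r ?nnegrE.
Qed.

(** Factor out the larger exponential, which is at most 1, and use [1 - exp (- z) <= z] at
    [z = (y ^ 2 - x ^ 2) / (2 s ^ 2)]. *)
Lemma normal_pdf0_dist (x y : R) : `|x| <= `|y| ->
  phi x - phi y <= normal_peak s * (y ^+ 2 - x ^+ 2) / (2 * s ^+ 2).
Proof.
move=> xy; rewrite !normal_pdf0E -mulrBr -mulrA ler_pM2l ?normal_peak_gt0//.
rewrite /gauss; set c := (2 * s ^+ 2)^-1.
have c0 : 0 < c by rewrite invr_gt0 mulr_gt0 ?exprn_gt0.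
have e1 : expR (- (c * x ^+ 2)) <= 1.
  by rewrite -[leRHS]expR0 ler_expR oppr_le0 mulr_ge0 ?sqr_ge0// ltW.
have xy2 : x ^+ 2 <= y ^+ 2.
  by rewrite -[leLHS]real_normK ?num_real// -[leRHS]real_normK ?num_real// lerXn2r ?nnegrE.
have -> : expR (- (c * y ^+ 2)) = expR (- (c * x ^+ 2)) * expR (- (c * (y ^+ 2 - x ^+ 2))).
  by rewrite -expRD; congr expR; ring.
have := expR_ge1Dx (- (c * (y ^+ 2 - x ^+ 2))).
have : 0 <= c * (y ^+ 2 - x ^+ 2) by rewrite mulr_ge0 ?(ltW c0)// subr_ge0.
set E := expR (- (c * x ^+ 2)); have E0 : 0 <= E by exact: expR_ge0.
set F := expR _; set z := c * _ => z0 F1.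
rewrite [leRHS]mulrC -/z; rewrite -/E in e1.
have h1 : E * (1 - F) <= E * z by rewrite ler_wpM2l//; lra.
have h2 : E * z <= z by rewrite ler_piMl.
lra.
Qed.

Lemma integrable_normal_pdf_itv (x : R) : mu.-integrable `[x, x + dl] (EFin \o phi).
Proof. by apply: integrableS (integrable_normal_pdf 0 s) => //; exact: measurable_itv. Qed.

Lemma Rintegral_itv_cst (x c : R) : \int[mu]_(t in `[x, x + dl]) c = dl * c.
Proof.
rewrite Rintegral_cst; last exact: measurable_itv.
rewrite /= lebesgue_measure_itv/= lte_fin ltrDl dl0 -EFinB/= mulrC; congr (_ * _); ring.
Qed.

Lemma integrable_itv_cst (x c : R) : mu.-integrable `[x, x + dl] (EFin \o (fun=> c)).
Proof.
apply: measurable_bounded_integrable => //.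
  by rewrite /= lebesgue_measure_itv/= lte_fin ltrDl dl0 -EFinB ltry.
exact: bounded_cst.
Qed.

(** Every point of the cell has modulus at most [|x| + dl], whatever the sign of [x], and the
    density decreases in the modulus. *)
Lemma quantised_gaussian_ge (x : R) : dl * phi (`|x| + dl) <= q x.
Proof.
rewrite -(Rintegral_itv_cst x); apply: le_Rintegral.
- exact: measurable_itv.
- exact: integrable_itv_cst.
- exact: integrable_normal_pdf_itv.
move=> t; rewrite /= in_itv/= => /andP[xt tx]; apply: normal_pdf0_le.
rewrite [leRHS]ger0_norm ?addr_ge0 ?(ltW dl0)//.
rewrite ler_norml; have := ler_norm x; have := ler_norm (- x); rewrite normrN => h1 h2.
by apply/andP; split; lra.
Qed.

Lemma quantised_gaussian_gt0 (x : R) : 0 < q x.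
Proof. by apply: lt_le_trans (quantised_gaussian_ge x); rewrite mulr_gt0// normal_pdf0_gt0. Qed.

(** One-sided, because an upper bound for [ln (p / q)] only asks that [q x] not fall far below
    [dl * phi x]. *)
Lemma quantised_gaussian_dist (x : R) :
  dl * phi x - q x <= dl * (normal_peak s * (dl * (2 * `|x| + dl)) / (2 * s ^+ 2)).
Proof.
have := quantised_gaussian_ge x.
have xy : `|x| <= `| `|x| + dl | by rewrite [leRHS]ger0_norm ?addr_ge0 ?lerDl// ltW.
have := normal_pdf0_dist xy.
have -> : (`|x| + dl) ^+ 2 - x ^+ 2 = dl * (2 * `|x| + dl).
  by rewrite -[x ^+ 2]real_normK ?num_real//; ring.
set A := _ / _ => h1 h2.
have : dl * (phi x - phi (`|x| + dl)) <= dl * A by rewrite ler_pM2l.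
by lra.
Qed.

Lemma esum_quantised_gaussian (a : R) :
  (\esum_(x in lattice a dl) (q x)%:E <= 1)%E.
Proof.
rewrite -(integral_normal_pdf 0 s).
(* Half-open cells are disjoint, unlike the closed ones of [quantised_gaussian], and carry the same
   integral. *)
rewrite (eq_esum (b := fun x => \int[mu]_(t in `[x, (x + dl)%R[) (phi t)%:E)%E); last first.
  move=> x _; rewrite integral_itv_bndo_bndc; last first.
    by apply/measurable_EFinP; apply: measurable_funTS; exact: measurable_normal_pdf.
  rewrite /quantised_gaussian /Rintegral fineK//.
  by apply: integrable_fin_num; [exact: measurable_itv|exact: integrable_normal_pdf_itv].
apply: esum_integral_le => //.
- move=> _ _ [j _ <-] [k _ <-] [t [/=]]; rewrite !in_itv/= => /andP[h1 h2] /andP[h3 h4].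
  have jk : (j < k + 1)%R.
    rewrite -(ltr_int R) -(ltr_pM2r dl0) intrD mulrDl mul1r; lra.
  have kj : (k < j + 1)%R.
    rewrite -(ltr_int R) -(ltr_pM2r dl0) intrD mulrDl mul1r; lra.
  congr (_ + _%:~R * _); apply/eqP; rewrite eq_le -!ltzD1.
  by rewrite jk kj.
- by apply/measurable_EFinP; exact: measurable_normal_pdf.
- by move=> x; rewrite lee_fin normal_pdf_ge0.
Qed.

End quantised_gaussian_bounds.

(** * Upper and lower bounds for relative entropy *)

Section relative_entropy_bounds.
Context d (T : measurableType d) (R : realType) (P : probability T R).
Variables (X : {RV P >-> R}) (A : set R) (q : R -> R).
Hypothesis q0 : forall x, 0 < q x.
Let p := pmf X.
Let p0 x : 0 <= p x. Proof. exact: pmf_ge0. Qed.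

Lemma entropy_termE (x y : R) : 0 < y -> entropy_term x y = (x * ln (x / y))%:E.
Proof.
by move=> y0; rewrite /entropy_term (gt_eqF y0); case: eqP => // ->; rewrite mul0r.
Qed.

Lemma ln_le_subr1 (x : R) : 0 < x -> ln x <= x - 1.
Proof.
move=> x0; have h : -1 < x - 1 by lra.
by have := le_ln1Dx h; rewrite addrC subrK.
Qed.

(** Discarding the subtracted sum only enlarges the value, and since [g] is nonnegative, [p g]
    dominates the positive part too where the logarithm is negative. *)
Lemma relative_entropy_le (g : R -> R) : measurable_fun setT g -> (forall x, 0 <= g x) ->
  (forall x, A x -> 0 < p x -> ln (p x / q x) <= g x) ->
  (relative_entropy A p q <= \int[P]_w (g (X w))%:E)%E.
Proof.
move=> mg g0 pg; apply: le_trans (esum_pmf_le X A mg g0).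
rewrite /relative_entropy/=.
set f := fun x => entropy_term (p x) (q x).
have fneg0 : (0 <= \esum_(x in A) f^\- x)%E by exact: esum_ge0.
apply: (@le_trans _ _ (\esum_(x in A) f^\+ x)%E).
  by rewrite geeDl// oppe_le0.
apply: le_esum => x Ax; rewrite funeposE /f entropy_termE//.
rewrite ge_max !lee_fin; apply/andP; split; last by rewrite mulr_ge0.
have [p00|/negbTE pn0] := eqVneq (p x) 0; first by rewrite -/(p x) p00 !mul0r.
by rewrite ler_wpM2l// pg// lt_neqAle eq_sym pn0/=.
Qed.

(** Gibbs' inequality from [ln y <= y - 1] at [y = q / p], that is [p - q <= p ln (p / q)]. The
    negative part lies below [q], so its sum is finite and the difference of sums is meaningful. *)
Lemma relative_entropy_ge0 : (\esum_(x in A) (q x)%:E <= 1)%E ->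
  (1 <= \esum_(x in A) (p x)%:E)%E -> (0 <= relative_entropy A p q)%E.
Proof.
move=> q1 p1; rewrite /relative_entropy/=.
set f := fun x => entropy_term (p x) (q x).
have fE x : f x = (p x * ln (p x / q x))%:E by exact: entropy_termE.
have f_ge x : p x - q x <= p x * ln (p x / q x).
  have [p00|/negbTE pn0] := eqVneq (p x) 0; first by rewrite p00 !mul0r sub0r oppr_le0 ltW.
  have px : 0 < p x by rewrite lt_neqAle eq_sym pn0/=.
  have := ln_le_subr1 (divr_gt0 (q0 x) px).
  rewrite -[q x / p x]invf_div lnV ?posrE ?divr_gt0// => h.
  have := ler_wpM2l (ltW px) h.
  rewrite mulrBr mulr1 invf_div mulrCA divff ?mulr1 ?gt_eqF//; lra.
have neg_q : (\esum_(x in A) f^\- x <= \esum_(x in A) (q x)%:E)%E.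
  apply: le_esum => x Ax; rewrite funenegE fE ge_max -EFinN !lee_fin.
  by rewrite (ltW (q0 x)) andbT; have := f_ge x; have := p0 x; lra.
have neg_fin : (\esum_(x in A) f^\- x)%E \is a fin_num.
  rewrite ge0_fin_numE; last exact: esum_ge0.
  by apply: le_lt_trans neg_q _; apply: le_lt_trans q1 _; rewrite ltry.
rewrite sube_ge0 ?neg_fin ?orbT//.
(* The pointwise inequality is rearranged with nonnegative terms on both sides, so that the sums
   split without subtracting infinities. *)
have : (\esum_(x in A) (f^\- x + (p x)%:E) <= \esum_(x in A) (f^\+ x + (q x)%:E))%E.
  apply: le_esum => x Ax; rewrite funenegE funeposE fE.
  rewrite -EFinN -[0%E]/(0%:E) -!EFin_max -!EFinD lee_fin.
  have := f_ge x; rewrite /Num.max; case: ifPn; case: ifPn; rewrite -?leNgt; lra.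
rewrite !esumD//; last 2 first.
- by move=> x _; rewrite lee_fin ltW.
- by move=> x _; rewrite lee_fin.
move=> H.
rewrite -(@leeD2rE _ 1%E)//.
apply: (@le_trans _ _ (\esum_(x in A) f^\- x + \esum_(x in A) (p x)%:E)%E).
  exact: leeD2l.
by apply: le_trans H _; exact: leeD2l.
Qed.

End relative_entropy_bounds.

Section second_moment_tail.
Context d (T : measurableType d) (R : realType) (P : probability T R).
Variables (X : {RV P >-> R}).
Hypothesis X2 : P.-integrable setT (EFin \o (fun w => X w ^+ 2)).

Lemma measurable_tail (M : R) : measurable [set x : R | M < `|x|].
Proof.
have mn : measurable_fun setT (fun x : R => `|x|) by exact: measurableT_comp.
have := mn measurableT _ (measurable_itv `]M, +oo[); rewrite setTI.
by congr measurable; apply/seteqP; split => x /=; rewrite in_itv/= andbT.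
Qed.

(* [2 (1 - cos (u x)) / u ^ 2] is at most [x ^ 2] everywhere, and at most
   [x ^ 2 / 2] as soon as [8 <= u ^ 2 x ^ 2]. *)
Lemma second_moment_tail_le (u M : R) : 0 < u -> 0 <= M -> 8 <= (u * M) ^+ 2 ->
  \int[P]_w (X w ^+ 2 * \1_[set x : R | M < `|x|] (X w)) <=
  2 * (\int[P]_w X w ^+ 2 - 2 * (1 - cf_re P X u) / u ^+ 2).
Proof.
move=> u0 M0 uM; have u20 : 0 < u ^+ 2 by rewrite exprn_gt0.
have i1 := integrable_cst_probability P (1 : R).
have icos := integrable_cosX X u.
have i3 : P.-integrable setT (EFin \o (fun w => 2 / u ^+ 2 * (1 - cos (u * X w)))).
  by apply: integrableZlR; exact: integrableBR.
have -> : 2 * (\int[P]_w X w ^+ 2 - 2 * (1 - cf_re P X u) / u ^+ 2) =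
    \int[P]_w (2 * (X w ^+ 2 - 2 / u ^+ 2 * (1 - cos (u * X w)))).
  rewrite RintegralZl//; last exact: integrableBR.
  rewrite RintegralB// RintegralZl//; last exact: integrableBR.
  rewrite RintegralB// Rintegral_cst_probability.
  by congr (_ * (_ - _)); rewrite mulrAC.
have cosb w : 2 / u ^+ 2 * (1 - cos (u * X w)) <= X w ^+ 2.
  have := cos_ge_taylor2 (u * X w); rewrite exprMn => h.
  by rewrite mulrAC ler_pdivrMr//; lra.
have iT : P.-integrable setT (EFin \o (fun w => X w ^+ 2 * \1_[set x : R | M < `|x|] (X w))).
  apply: le_integrable X2 => //.
    apply/measurable_EFinP; apply: measurable_funM; first exact: measurable_funX.
    apply: measurableT_comp => //; apply: measurable_indic; exact: measurable_tail.
  move=> w _; rewrite lee_fin /= normrM ler_piMr//.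
  by rewrite indicE; case: (_ \in _); rewrite ?normr1 ?normr0.
apply: le_Rintegral => //; first by apply: integrableZlR; exact: integrableBR.
move=> w _; have := cosb w; rewrite indicE.
have [/set_mem/= MX|_] := boolP (X w \in _); last by rewrite mulr0 pmulr_rge0// subr_ge0.
move=> _; rewrite mulr1.
have X8 : 8 <= u ^+ 2 * X w ^+ 2.
  rewrite (le_trans uM)// exprMn ler_pM2l// -[leRHS]real_normK ?num_real//.
  by rewrite lerXn2r ?nnegrE// ltW.
have : 2 / u ^+ 2 * (1 - cos (u * X w)) <= X w ^+ 2 / 2.
  by have := cos_geN1 (u * X w); rewrite mulrAC ler_pdivrMr//; lra.
lra.
Qed.

End second_moment_tail.

(** * Logarithm of the ratio between the law and the quantised Gaussian *)

Section quantised_gaussian_comparison.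
Variable R : realType.
Variables (s dl : R).
Hypotheses (s0 : 0 < s) (dl0 : 0 < dl) (dl1 : dl <= 1).
Notation phi := (normal_pdf 0 s).
Notation q := (quantised_gaussian 0 s dl).
Let peak := normal_peak s.
Let peak0 : 0 < peak. Proof. by rewrite normal_peak_gt0// gt_eqF. Qed.

(** By [ln r <= r - 1] it suffices to bound [(p - q) / q]: the numerator is at most [dl] times the
    bracket, the denominator at least [dl * phi (M + 1)], and [dl] cancels. The maximum with 0
    covers [p <= q]. *)
Lemma ln_quantised_gaussian_central (p x I M : R) : 0 < p -> `|x| <= M ->
  p <= dl * (phi x + I) ->
  ln (p / q x) <= Num.max 0 ((I + peak * (2 * M + 1) / (2 * s ^+ 2) * dl) / phi (M + 1)).
Proof.
move=> p0 xM pI; have q0 := quantised_gaussian_gt0 s0 dl0 x.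
rewrite le_max; have [pq|qp] := leP p (q x).
  by apply/orP; left; apply: ln_le0; rewrite ler_pdivrMr// mul1r.
apply/orP; right; apply: (le_trans (ln_le_subr1 (divr_gt0 p0 q0))).
have -> : p / q x - 1 = (p - q x) / q x by rewrite mulrBl divff// gt_eqF.
have M0 : 0 <= M by apply: le_trans xM.
have m0 : 0 < phi (M + 1) by exact: normal_pdf0_gt0.
have qm : dl * phi (M + 1) <= q x.
  apply: le_trans (quantised_gaussian_ge s0 dl0 x); rewrite ler_pM2l// normal_pdf0_le//.
  rewrite (@ger0_norm _ (`|x| + dl)) ?addr_ge0 ?(ltW dl0)//.
  by rewrite (@ger0_norm _ (M + 1)) ?addr_ge0// lerD.
have pqN : p - q x <= dl * (I + peak * (2 * M + 1) / (2 * s ^+ 2) * dl).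
  have := quantised_gaussian_dist s0 dl0 x; rewrite -/peak.
  have : dl * (peak * (dl * (2 * `|x| + dl)) / (2 * s ^+ 2)) <=
         dl * (peak * (2 * M + 1) / (2 * s ^+ 2) * dl).
    rewrite ler_pM2l// [leRHS]mulrAC ler_pM2r ?invr_gt0 ?mulr_gt0 ?exprn_gt0//.
    rewrite -[leRHS]mulrA ler_pM2l// mulrC ler_pM2r//. 
    by apply: lerD => //; rewrite ler_pM2l.
  lra.
have pq0 : 0 <= p - q x by rewrite subr_ge0 ltW.
rewrite ler_pdivrMr// mulrAC ler_pdivlMr//.
apply: (@le_trans _ _ (dl * (I + peak * (2 * M + 1) / (2 * s ^+ 2) * dl) * phi (M + 1))).
  by rewrite ler_pM2r.
rewrite mulrAC mulrC ler_wpM2l//.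
rewrite -(pmulr_rge0 _ dl0); exact: le_trans pqN.
Qed.

(** From [dl <= 1 <= |x|] come the crude bounds [p <= dl (peak + 1)] and [q >= dl * phi (2 |x|)].
    The logarithm of their ratio is a constant plus [2 x ^ 2 / s ^ 2], and [1 <= x ^ 2] absorbs the
    constant. *)
Lemma ln_quantised_gaussian_tail (p x I : R) : 0 < p -> 1 <= `|x| -> I <= 1 ->
  p <= dl * (phi x + I) ->
  ln (p / q x) <= (ln ((peak + 1) / peak) + 2 / s ^+ 2) * x ^+ 2.
Proof.
move=> p0 x1 I1 pI; have q0 := quantised_gaussian_gt0 s0 dl0 x.
have s20 : 0 < s ^+ 2 by rewrite exprn_gt0.
have x21 : 1 <= x ^+ 2 by rewrite -[leRHS]real_normK ?num_real// exprn_ege1.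
have L0 : 0 <= ln ((peak + 1) / peak).
  by rewrite ln_ge0// ler_pdivlMr// mul1r lerDl.
apply: (@le_trans _ _ (ln ((peak + 1) / peak * expR (2 / s ^+ 2 * x ^+ 2)))); last first.
  rewrite lnM ?posrE ?expR_gt0 ?divr_gt0 ?addr_gt0// expRK.
  by rewrite [leRHS]mulrDl lerD2r ler_peMr.
have r0 : 0 < (peak + 1) / peak by rewrite divr_gt0// addr_gt0.
rewrite ler_ln ?posrE ?(divr_gt0 p0 q0)//; last by rewrite mulr_gt0// expR_gt0.
rewrite ler_pdivrMr//.
have qx : dl * phi (2 * `|x|) <= q x.
  apply: le_trans (quantised_gaussian_ge s0 dl0 x); rewrite ler_pM2l// normal_pdf0_le//.
  rewrite (@ger0_norm _ (`|x| + dl)) ?addr_ge0 ?(ltW dl0)//.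
  by rewrite [leRHS]ger0_norm ?mulr_ge0// mulr2n mulrDl !mul1r lerD2l (le_trans dl1).
have pb : p <= dl * (peak + 1).
  rewrite (le_trans pI)// ler_pM2l// lerD// normal_pdf_ub// gt_eqF//.
apply: (le_trans pb).
apply: (@le_trans _ _ ((peak + 1) / peak * expR (2 / s ^+ 2 * x ^+ 2) * (dl * phi (2 * `|x|)))); last first.
  by rewrite ler_pM2l// mulr_gt0 ?expR_gt0 ?divr_gt0 ?addr_gt0.
rewrite normal_pdf0E// -/peak /gauss.
have -> : (2 * s ^+ 2)^-1 * (2 * `|x|) ^+ 2 = 2 / s ^+ 2 * x ^+ 2.
  by rewrite exprMn real_normK ?num_real//; field; rewrite gt_eqF.
set z := 2 / s ^+ 2 * x ^+ 2.
have -> : (peak + 1) / peak * expR z * (dl * (peak * expR (- z))) =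
  (dl * (peak + 1)) * (expR z * expR (- z)) by field; rewrite gt_eqF.
by rewrite -expRD subrr expR0 mulr1.
Qed.

End quantised_gaussian_comparison.

Section expectation_as_Rintegral.
Context d (T : measurableType d) (R : realType) (P : probability T R).

Lemma fine_expectationE (X : {RV P >-> R}) : fine 'E_P[X] = \int[P]_w X w.
Proof. by rewrite unlock. Qed.

Lemma fine_varianceE (X : {RV P >-> R}) :
  fine 'V_P[X] = \int[P]_w (X w - \int[P]_w X w) ^+ 2.
Proof.
rewrite /variance covariance.unlock /= fine_expectationE.
by rewrite expectation.unlock; apply: eq_Rintegral => w _ /=; rewrite expr2.
Qed.

End expectation_as_Rintegral.

(** * Convergence of the relative entropy for centred sequences *)

Section centred_entropic_limit.
Context d (T : measurableType d) (R : realType) (P : probability T R).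
Variable Y : nat -> {RV P >-> R}.
Hypothesis Yindep : mutually_independent P Y.
Hypothesis Yident : identically_distributed P Y.
Hypothesis Y2 : P.-integrable setT (EFin \o (fun w => Y 0%N w ^+ 2)).
Hypothesis Y1 : \int[P]_w Y 0%N w = 0.
Variables (a h : R).
Hypothesis Yspan : has_maximal_span P (Y 0%N) h.
Hypothesis Ylattice : support_of P (Y 0%N) `<=` lattice a h.
Let v := \int[P]_w Y 0%N w ^+ 2.
Let h0 : 0 < h. Proof. by case: Yspan => -[]. Qed.
Let v0 : 0 < v. Proof. exact: (variance_gt0 Y2 Yspan Ylattice). Qed.
Let s := Num.sqrt v.
Let s0 : 0 < s. Proof. by rewrite sqrtr_gt0. Qed.
Let sv : s ^+ 2 = v. Proof. by rewrite sqr_sqrtr// ltW. Qed.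
Let peak := normal_peak s.
Let peak0 : 0 < peak. Proof. by rewrite normal_peak_gt0// gt_eqF. Qed.
Let dl n : R := h / Num.sqrt n%:R.
Let S n : {RV P >-> R} := normalised_sum Y n.

Lemma normalised_sum_fine_expectation n : fine 'E_P[normalised_sum Y n] = 0.
Proof. by rewrite fine_expectationE (normalised_sum_mean Yindep Yident Y2 Y1). Qed.

Lemma normalised_sum_fine_variance n : (0 < n)%N -> fine 'V_P[normalised_sum Y n] = v.
Proof.
move=> n0; rewrite fine_varianceE (normalised_sum_mean Yindep Yident Y2 Y1).
rewrite -[RHS](normalised_sum_variance Yindep Yident Y2 Y1 n0).
by apply: eq_Rintegral => w _; rewrite subr0.
Qed.

(** In [second_moment_tail_le], [1 - cf_re] is bounded below through
    [exp (- y) <= 1 - y + y ^ 2 / 2] at [y = v u ^ 2 / 2], whose linear term cancels the variance.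
    Of what is left, the first term is small with [u] uniformly in [n], the second vanishes as [n]
    grows for fixed [u]. *)
Lemma normalised_sum_second_moment_tail n u M : (0 < n)%N -> 0 < u -> 0 <= M ->
  8 <= (u * M) ^+ 2 ->
  \int[P]_w (S n w ^+ 2 * \1_[set x : R | M < `|x|] (S n w)) <=
  v ^+ 2 * u ^+ 2 / 2 + 4 / u ^+ 2 * `|cf_re P (S n) u - gauss (v / 2) u|.
Proof.
move=> n0 u0 M0 uM; have u20 : 0 < u ^+ 2 by rewrite exprn_gt0.
apply: (le_trans (second_moment_tail_le (integrable_normalised_sum_sqr Yindep Yident Y2 Y1 n) u0 M0 uM)).
rewrite (normalised_sum_variance Yindep Yident Y2 Y1 n0) -/v -/(S n).
set tau := `|_|.
have y0 : 0 <= v / 2 * u ^+ 2 by rewrite mulr_ge0 ?divr_ge0 ?(ltW v0) ?(ltW u20).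
have C1 : cf_re P (S n) u <= 1 - v / 2 * u ^+ 2 + (v / 2 * u ^+ 2) ^+ 2 / 2 + tau.
  have h1 := expRN_le_taylor2 y0; have h2 := ler_norm (cf_re P (S n) u - gauss (v / 2) u).
  by move: h2; rewrite -/tau /gauss; lra.
have h3 : 2 * (v / 2 * u ^+ 2 - (v / 2 * u ^+ 2) ^+ 2 / 2 - tau) / u ^+ 2 <=
          2 * (1 - cf_re P (S n) u) / u ^+ 2.
  by rewrite ler_pM2r ?invr_gt0// ler_pM2l//; lra.
have h4 : 2 * (v / 2 * u ^+ 2 - (v / 2 * u ^+ 2) ^+ 2 / 2 - tau) / u ^+ 2 =
   v - v ^+ 2 * u ^+ 2 / 4 - 2 / u ^+ 2 * tau by field; rewrite gt_eqF.
rewrite h4 in h3; lra.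
Qed.

Lemma gaussian_entropy_normalised_sum_cvg0 :
  gaussian_entropy P (Num.sqrt n%:R * a) (h / Num.sqrt n%:R) (normalised_sum Y n)
    @[n --> \oo] --> 0%E.
Proof.
(* Lying between 0 and a real [e] also yields the finiteness that convergence in the extended reals
   demands. *)
suff main (e : R) : 0 < e -> \forall n \near \oo, (0 <=
    gaussian_entropy P (Num.sqrt n%:R * a) (h / Num.sqrt n%:R) (normalised_sum Y n) <= e%:E)%E.
  apply/fine_cvgP; split.
    near=> n; have /andP[h1 h2] : (0 <= gaussian_entropy P (Num.sqrt n%:R * a) (h / Num.sqrt n%:R) (normalised_sum Y n) <= 1%:E)%E.
      by near: n; exact: main.
    by rewrite ge0_fin_numE// (le_lt_trans h2)// ltry.
  apply/cvgrPdist_le => e e0; near=> n.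
  have /andP[h1 h2] : (0 <= gaussian_entropy P (Num.sqrt n%:R * a) (h / Num.sqrt n%:R) (normalised_sum Y n) <= e%:E)%E.
    by near: n; exact: main.
  rewrite sub0r normrN /= ger0_norm ?fine_ge0//.
  by rewrite -lee_fin fineK// ge0_fin_numE// (le_lt_trans h2)// ltry.
move=> e0; have [I I0 hI] := local_limit_lattice Yindep Yident Y2 Y1 Yspan Ylattice.
pose K := ln ((peak + 1) / peak) + 2 / v.
have K0 : 0 < K.
  by rewrite /K ltr_wpDl ?divr_gt0// ln_ge0// ler_pdivlMr// mul1r lerDl.
(* The second bound makes the part of the tail independent of [n] cost at most [e / 4]; the first
   gives [u <= 1], hence the [M >= 1] required by the tail bound on the logarithm. *)
pose u2 := Num.min 1 (e / (2 * K * v ^+ 2)).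
have u20 : 0 < u2 by rewrite lt_min ltr01/= divr_gt0// !mulr_gt0// exprn_gt0.
pose u := Num.sqrt u2; have u0 : 0 < u by rewrite sqrtr_gt0.
have uE : u ^+ 2 = u2 by rewrite sqr_sqrtr// ltW.
have u1 : u <= 1.
  by rewrite -[leRHS]sqrtr1 ler_wsqrtr// ge_min lexx.
have Ku : K * (v ^+ 2 * u ^+ 2 / 2) <= e / 4.
  have : u2 <= e / (2 * K * v ^+ 2) by rewrite ge_min lexx orbT.
  rewrite uE ler_pdivlMr ?mulr_gt0 ?exprn_gt0//; lra.
(* With this choice [(u M) ^ 2 = 9], above the threshold 8. *)
pose M := 3 / u; have M1 : 1 <= M by rewrite ler_pdivlMr// mul1r; lra.
have M0 : 0 <= M by apply: le_trans M1.
have uM : 8 <= (u * M) ^+ 2.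
  by rewrite /M mulrCA divff ?gt_eqF// mulr1; lra.
pose N n := (I n + peak * (2 * M + 1) / (2 * s ^+ 2) * dl n) / normal_pdf 0 s (M + 1).
have dl_cvg : dl n @[n --> \oo] --> 0.
  by rewrite -(mulr0 h); apply: cvgMr; exact: cvg_natV_sqrt.
have N_cvg : N n @[n --> \oo] --> 0.
  rewrite -(mul0r (normal_pdf 0 s (M + 1))^-1); apply: cvgMl.
  rewrite -[0](addr0 0); apply: cvgD => //.
  by rewrite -[0](mulr0 (peak * (2 * M + 1) / (2 * s ^+ 2))); apply: cvgMr.
have tau_cvg : K * (4 / u ^+ 2 * `|cf_re P (S n) u - gauss (v / 2) u|) @[n --> \oo] --> 0.
  rewrite -(mulr0 K); apply: cvgMr; rewrite -(mulr0 (4 / u ^+ 2)); apply: cvgMr.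
  apply: (@squeeze_cvgr _ _ _ _ (cst 0) _ _ _ _ _ (cvg_cf_sum Yindep Yident Y2 Y1 u)).
    by apply: nearW => n; rewrite normr_ge0/= /S cf_re_normalised_sum// lerDl.
  exact: cvg_cst.
near=> n.
have n0 : (0 < n)%N by near: n; exact: nbhs_infty_gt.
have n0' : 0 < Num.sqrt n%:R :> R by rewrite sqrtr_gt0 ltr0n.
have dl0 : 0 < dl n by rewrite divr_gt0.
have I1 : I n < 1 by near: n; exact: (cvgr_lt 0).
have dl1 : dl n < 1 by near: n; exact: (cvgr_lt 0).
have Ne : N n < e / 2 by near: n; apply: (cvgr_lt 0) => //; rewrite divr_gt0.
have te : K * (4 / u ^+ 2 * `|cf_re P (S n) u - gauss (v / 2) u|) < e / 4.
  by near: n; apply: (cvgr_lt 0) => //; rewrite divr_gt0.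
rewrite /gaussian_entropy normalised_sum_fine_expectation normalised_sum_fine_variance// -/s -/(dl n) -/(S n).
have q0 x : 0 < quantised_gaussian 0 s (dl n) x by exact: quantised_gaussian_gt0.
apply/andP; split.
  apply: relative_entropy_ge0 => //; first exact: esum_quantised_gaussian.
  by apply: esum_pmf_lattice; exact: (normalised_sum_lattice Yident Ylattice n0).
(* The budget: [e / 2] for the centre and twice [e / 4] for the expectation of the tail term. *)
pose g x := e / 2 + K * (x ^+ 2 * \1_[set x : R | M < `|x|] x).
have mtail : measurable_fun setT (fun x : R => x ^+ 2 * \1_[set x : R | M < `|x|] x).
  apply: measurable_funM; first exact: measurable_funX.
  by apply: measurable_indic; exact: measurable_tail.
have mg : measurable_fun setT g by apply: measurable_funD => //; exact: measurable_funM.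
have g0 x : 0 <= g x.
  by rewrite /g addr_ge0 ?divr_ge0 ?(ltW e0)// mulr_ge0 ?(ltW K0)// mulr_ge0// sqr_ge0.
apply: (@le_trans _ _ (\int[P]_w (g (S n w))%:E)%E).
  apply: relative_entropy_le => // x xl px.
  have pI : pmf (S n) x <= dl n * (normal_pdf 0 s x + I n).
    have := hI n x n0 xl; rewrite -/(dl n) -/s -/(S n) ler_norml => /andP[_].
    by rewrite mulrDr; lra.
  have [xM|Mx] := leP `|x| M.
    apply: (le_trans (ln_quantised_gaussian_central s0 dl0 (ltW dl1) px xM pI)).
    rewrite ge_max g0/=; apply: (@le_trans _ _ (e / 2)); first exact: ltW.
    by rewrite /g lerDl mulr_ge0 ?(ltW K0)// mulr_ge0// sqr_ge0.
  have x1 : 1 <= `|x| by rewrite (le_trans M1)// ltW.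
  apply: (le_trans (ln_quantised_gaussian_tail s0 dl0 (ltW dl1) px x1 (ltW I1) pI)).
  by rewrite /g indicE mem_set// mulr1 -/peak sv -/K lerDr divr_ge0// ltW.
have S2 := integrable_normalised_sum_sqr Yindep Yident Y2 Y1 n.
have i1 := integrable_cst_probability P (e / 2).
have iT : P.-integrable setT (EFin \o (fun w => S n w ^+ 2 * \1_[set x : R | M < `|x|] (S n w))).
  apply: le_integrable S2 => //.
    by apply/measurable_EFinP; exact: (measurableT_comp mtail).
  move=> w _; rewrite lee_fin /= normrM ler_piMr//.
  by rewrite indicE; case: (_ \in _); rewrite ?normr1 ?normr0.
have iKT := integrableZlR K iT.
have -> : (\int[P]_w (g (S n w))%:E = (\int[P]_w g (S n w))%:E)%E.
  by rewrite /Rintegral fineK//; apply: integrable_fin_num => //; exact: integrableDR.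
rewrite lee_fin RintegralD// Rintegral_cst_probability RintegralZl//.
have := normalised_sum_second_moment_tail n0 u0 M0 uM => /(ler_wpM2l (ltW K0)).
by rewrite mulrDr; lra.
Unshelve. all: by end_near. Qed.

End centred_entropic_limit.

(** * Invariance under translation *)

Section translation.
Context d (T : measurableType d) (R : realType) (P : probability T R).

Lemma relative_entropy_reindex (A B : set R) (e p q : R -> R) : set_bij A B e ->
  relative_entropy A (p \o e) (q \o e) = relative_entropy B p q.
Proof.
move=> eAB; rewrite /relative_entropy; congr (_ - _)%E.
  by rewrite [RHS](reindex_esum A B e _ eAB); apply: eq_esum => x _; rewrite !funeposE.
by rewrite [RHS](reindex_esum A B e _ eAB); apply: eq_esum => x _; rewrite !funenegE.
Qed.

Lemma quantised_gaussian_translate (m s h c x : R) : s != 0 -> 0 <= h ->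
  quantised_gaussian (m - c) s h x = quantised_gaussian m s h (x + c).
Proof.
move=> s0 h0; rewrite /quantised_gaussian /Rintegral; congr fine.
pose F (t : R) := t + c.
have dF (t : R) : is_derive t 1 F 1.
  by rewrite -[X in is_derive _ _ _ X]addr0; apply: is_deriveD.
have F'E : derive1 F = cst 1 by apply/funext => t; rewrite derive1E derive_val.
have cF : continuous F by exact: continuous_is_derive dF.
rewrite (addrAC x c h) -/(F x) -/(F (x + h)).
rewrite (@integration_by_substitution_increasing _ F (normal_pdf m s)) ?lerDl//.
- apply: eq_integral => t _; rewrite F'E /= fctE/= mulr1 !normal_pdfE//.
  by rewrite /normal_fun /F (_ : t - (m - c) = t + c - m)//; ring.
- by move=> t u _ _; rewrite /F ltrD2r.
- by rewrite F'E => t _; exact: cst_continuous.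
- by rewrite F'E; exact: is_cvg_cst.
- by rewrite F'E; exact: is_cvg_cst.
- split => //.
  + by apply: cvg_at_right_filter; exact: cF.
  + by apply: cvg_at_left_filter; exact: cF.
- by apply: continuous_subspaceT; exact: continuous_normal_pdf.
Qed.

Variables (X Z : {RV P >-> R}) (c : R).
Hypothesis ZX : forall w, Z w = X w - c.

Lemma support_of_translate x : support_of P Z x = support_of P X (x + c).
Proof.
apply/propext; split => H U [oU Ux].
- have -> : X @^-1` U = Z @^-1` ((fun t => t + c) @^-1` U).
    by apply/seteqP; split => w /=; rewrite ZX subrK.
  apply: H; split => //; apply: open_comp oU => t _.
  by apply: continuousD => //; exact: cst_continuous.
- have -> : Z @^-1` U = X @^-1` ((fun t => t - c) @^-1` U).
    by apply/seteqP; split => w /=; rewrite ZX.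
  apply: H; split; last by rewrite /= addrK.
  apply: open_comp oU => t _.
  by apply: continuousB => //; exact: cst_continuous.
Qed.

Lemma support_translate_lattice a h :
  support_of P X `<=` lattice a h -> support_of P Z `<=` lattice (a - c) h.
Proof.
by move=> XA x; rewrite support_of_translate => /XA[k _ kx]; exists k => //; lra.
Qed.

Lemma pmf_translate x : pmf Z x = pmf X (x + c).
Proof.
rewrite /pmf; congr (fine (P _)); apply/seteqP; split => w /=; rewrite ZX.
  by move=> <-; rewrite subrK.
by move=> ->; rewrite addrK.
Qed.

Hypothesis X1 : P.-integrable setT (EFin \o X).

Lemma fine_expectation_translate : fine 'E_P[Z] = fine 'E_P[X] - c.
Proof.
rewrite !fine_expectationE (@eq_Rintegral _ _ _ _ _ (fun w => X w - c)) => [|w _]; last exact: ZX.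
by rewrite RintegralB// ?Rintegral_cst_probability//; exact: integrable_cst_probability.
Qed.

Lemma fine_variance_translate : fine 'V_P[Z] = fine 'V_P[X].
Proof.
rewrite !fine_varianceE -!fine_expectationE fine_expectation_translate.
by apply: eq_Rintegral => w _; rewrite ZX; congr (_ ^+ 2); ring.
Qed.

Lemma gaussian_entropy_translate a h : 0 <= h -> 0 < fine 'V_P[X] ->
  gaussian_entropy P (a - c) h Z = gaussian_entropy P a h X.
Proof.
move=> h0 V0; rewrite /gaussian_entropy fine_expectation_translate fine_variance_translate.
rewrite -[RHS](@relative_entropy_reindex (lattice (a - c) h) _ (fun x => x + c)).
  congr relative_entropy; apply/funext => x; first exact: pmf_translate.
  by apply: quantised_gaussian_translate => //; rewrite gt_eqF// sqrtr_gt0.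
split.
- by move=> x [k _ <-]; exists k => //; ring.
- by move=> x y _ _ /addIr.
- by move=> x [k _ <-]; exists (a - c + k%:~R * h); [exists k|ring].
Qed.

End translation.

Section translated_span.
Context d (T : measurableType d) (R : realType) (P : probability T R).

Lemma has_span_translate (X Z : {RV P >-> R}) (c h : R) : (forall w, Z w = X w - c) ->
  has_span P X h -> has_span P Z h.
Proof.
by move=> ZX [h0 [a Xa]]; split=> //; exists (a - c); exact: (support_translate_lattice ZX).
Qed.

Lemma has_maximal_span_translate (X Z : {RV P >-> R}) (c h : R) : (forall w, Z w = X w - c) ->
  has_maximal_span P X h -> has_maximal_span P Z h.
Proof.
move=> ZX [Xh hmax]; split; first exact: has_span_translate Xh.
(* [X] is [Z] shifted back by [- c], so every span of [Z] is one of [X]. *)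
move=> h' Zh'; apply: hmax; apply: (has_span_translate _ Zh') => w.
by rewrite ZX; instantiate (1 := - c); ring.
Qed.

End translated_span.

(** * Reduction to the centred sequence *)

Section centred_sequence.
Context d (T : measurableType d) (R : realType) (P : probability T R).
Variables (X : nat -> {RV P >-> R}) (mu : R).
Notation Y := (centred X mu).

Lemma measurable_preimage_subr (B : set R) : measurable B -> measurable ((fun x : R => x - mu) @^-1` B).
Proof.
move=> mB; rewrite -[X in measurable X]setTI.
by apply: (measurable_funB (f := id) (g := cst mu)).
Qed.

Lemma centred_independent : mutually_independent P X -> mutually_independent P Y.
Proof.
by move=> iX J B mB; apply: (iX J (fun i => (fun x => x - mu) @^-1` B i)) => i; exact: measurable_preimage_subr.
Qed.

Lemma centred_identically_distributed : identically_distributed P X -> identically_distributed P Y.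
Proof.
by move=> iX i j B mB; exact: (iX i j _ (measurable_preimage_subr mB)).
Qed.

Lemma normalised_sum_centred n w :
  normalised_sum Y n w = normalised_sum X n w - Num.sqrt n%:R * mu.
Proof.
rewrite /normalised_sum sumrB sumr_const card_ord mulrBr; congr (_ - _).
(* At [n = 0] both sides of the remaining equation are 0, through [sqrt 0 = 0]. *)
have [->|n0] := posnP n; first by rewrite mulr0n sqrtr0 mulr0 mul0r.
rewrite -[mu *+ n]mulr_natl mulrA; congr (_ * _).
rewrite -{2}(@sqr_sqrtr _ n%:R)// expr2 mulKf// gt_eqF// sqrtr_gt0 ltr0n//.
Qed.

End centred_sequence.

Section finite_moments.
Context d (T : measurableType d) (R : realType) (P : probability T R).

Lemma expectation_fin_num_integrable (X : {RV P >-> R}) :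
  'E_P[X]%E \is a fin_num -> P.-integrable setT (EFin \o X).
Proof.
rewrite unlock => EX; apply/integrableP; split; first exact/measurable_EFinP.
by have := EX; rewrite -integral_fin_num_abs.
Qed.

Lemma variance_fin_integrable (X : {RV P >-> R}) (mu : R) : 'E_P[X]%E = mu%:E ->
  ('V_P[X] < +oo)%E -> P.-integrable setT (EFin \o (fun w => (X w - mu) ^+ 2)).
Proof.
move=> EX; rewrite /variance covariance.unlock EX /= expectation.unlock => VX.
apply/integrableP; split.
  by apply/measurable_EFinP; apply: measurable_funX; exact: measurable_funB.
apply: le_lt_trans VX; rewrite le_eqVlt; apply/orP; left; apply/eqP.
by apply: eq_integral => w _ /=; rewrite ger0_norm ?sqr_ge0// expr2.
Qed.

End finite_moments.

(** Equality is stated for positive [n], since at 0 the step [h / sqrt 0] of the lattice is 0. The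
    limit is obtained for the centred sums and carried over by this equality. *)
Theorem theorem1p2 (d : measure_display) (T : measurableType d) (R : realType)
  (P : probability T R) (X : nat -> {RV P >-> R}) (a h mu : R)
  (X_indep : mutually_independent P X)
  (X_ident : identically_distributed P X)
  (X_span : has_maximal_span P (X 0%N) h)
  (X_lattice : support_of P (X 0%N) `<=` lattice a h)
  (X_mean : 'E_P[X 0%N]%E = mu%:E)
  (X_var : ('V_P[X 0%N] < +oo)%E) :
  (forall n : nat, (0 < n)%N ->
     gaussian_entropy P (Num.sqrt n%:R * (a - mu)) (h / Num.sqrt n%:R)
       (normalised_sum (centred X mu) n) =
     gaussian_entropy P (Num.sqrt n%:R * a) (h / Num.sqrt n%:R)
       (normalised_sum X n)) /\
  gaussian_entropy P (Num.sqrt n%:R * a) (h / Num.sqrt n%:R)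
    (normalised_sum X n) @[n --> \oo] --> 0%E.
Proof.
pose Y := centred X mu.
have Y_indep : mutually_independent P Y by exact: centred_independent.
have Y_ident : identically_distributed P Y by exact: centred_identically_distributed.
have YX w : Y 0%N w = X 0%N w - mu by [].
have Y_span := has_maximal_span_translate YX X_span.
have Y_lattice := support_translate_lattice YX X_lattice.
have Y2 : P.-integrable setT (EFin \o (fun w => Y 0%N w ^+ 2)).
  exact: (variance_fin_integrable X_mean X_var).
have X1 : P.-integrable setT (EFin \o X 0%N).
  by apply: expectation_fin_num_integrable; rewrite X_mean.
have Y1 : \int[P]_w Y 0%N w = 0.
  by rewrite -fine_expectationE (fine_expectation_translate YX X1) X_mean subrr.
have h0 : 0 < h by case: X_span => -[].
have v0 := variance_gt0 Y2 Y_span Y_lattice.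
have translate n : (0 < n)%N ->
    gaussian_entropy P (Num.sqrt n%:R * (a - mu)) (h / Num.sqrt n%:R) (normalised_sum Y n) =
    gaussian_entropy P (Num.sqrt n%:R * a) (h / Num.sqrt n%:R) (normalised_sum X n).
  move=> n0; have SYX w := normalised_sum_centred X mu n w.
  (* Integrability of the uncentred sum is recovered by adding a constant to the centred one, which
     is square integrable. *)
  have SX1 : P.-integrable setT (EFin \o (normalised_sum X n : {RV P >-> R})).
    have SY1 := integrable_sqr_integrable (integrable_normalised_sum_sqr Y_indep Y_ident Y2 Y1 n).
    have -> : EFin \o normalised_sum X n =
        EFin \o (fun w => normalised_sum Y n w + Num.sqrt n%:R * mu).
      by apply/funext => w /=; rewrite SYX subrK.
    by apply: integrableDR => //; exact: integrable_cst_probability.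
  rewrite mulrBr; apply: (gaussian_entropy_translate SYX SX1).
    by rewrite divr_ge0 ?sqrtr_ge0// ltW.
  rewrite -(fine_variance_translate SYX SX1).
  by rewrite (normalised_sum_fine_variance Y_indep Y_ident Y2 Y1 n0).
split; first exact: translate.
apply: cvg_trans (gaussian_entropy_normalised_sum_cvg0 Y_indep Y_ident Y2 Y1 Y_span Y_lattice).
apply: near_eq_cvg; near=> n; apply: translate.
by near: n; exact: nbhs_infty_gt.
Unshelve. all: by end_near. Qed.
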